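(* Let $a,b,d$ be three pairwise coprime positive integers with $d\notin\langle a,b\rangle$, and let $S=\langle a,b\rangle/d$. Let $m\in\{1,\dots,d-1\}$ with $am+b\equiv0\pmod d$, $\alpha=m/d$ with continued fraction expansion $[0,a_1,\dots,a_r,1]$, convergents $p_k/q_k$ and $\delta_k=(-1)^k(q_k\alpha-p_k)$. Put $\tau=\frac{am+b}{d}$ and $\mu_i=\tau q_i-ap_i$ for $i\in\{0,\dots,r\}$. When $a<d$, let $(N_1,\dots,N_s)$ be the $\alpha$-numeration of $a-1$ with $N_s>0$, and set $x_0=d(\delta_{s-2}-N_s\delta_{s-1})$ and $\nu=N_s$ if $s$ is even, $x_0=d\delta_{s-1}$ and $\nu=0$ if $s$ is odd. In each case below, the elements listed in the description of $\mathrm{Irr}(S)$ are pairwise distinct. Case 1: $d<a<b$. Then $e(S)=3+\sum_{k=1}^{\lfloor r/2\rfloor}a_{2k}$ and $\mathrm{Irr}(S)=\{a,\ b,\ \tau\}\cup\{\mu_{2k-2}+j\mu_{2k-1}: k\in\{1,\dots,\lfloor r/2\rfloor\},\ j\in\{1,\dots,a_{2k}\}\}$. Case 2: $a<d<b$, or ($a<b<d$ and $x_0+b>d$). Then $e(S)=2+\sum_{k=1}^{\lfloor (s-1)/2\rfloor}a_{2k}+\nu$ and $\mathrm{Irr}(S)$ consists of $a$, $\tau$, the numbers $\mu_{2k-2}+j\mu_{2k-1}$ for $k\in\{1,\dots,\lfloor (s-1)/2\rfloor\}$, $j\in\{1,\dots,a_{2k}\}$, and, when $s$ is even, the numbers $\mu_{s-2}+j\mu_{s-1}$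 for $j\in\{1,\dots,N_s\}$. Case 3: $a<b<d$ and $m<x_0+b\leqslant d$. Then $\mathrm{Irr}(S)$ is as in Case 2 with $a$ removed ($a\notin\mathrm{Irr}(S)$), and $e(S)=1+\sum_{k=1}^{\lfloor (s-1)/2\rfloor}a_{2k}+\nu$. Case 4: $a<b<d$ and $x_0+b\leqslant m$. Let $\beta=\frac{x_0+b-1}{d}$ with $\alpha$-numeration $(b_1,\dots,b_{s'})$, $b_{s'}>0$; let $t=\min\{i>0: b_{2i+1}>0\}$, and $t=\lfloor s'/2\rfloor$ if $b_{2i+1}=0$ for all $i>0$. Then $a\notin\mathrm{Irr}(S)$, $$\mathrm{Irr}(S)=\{\mu_{2k-2}+j\mu_{2k-1}: k\in\{t,\dots,\lfloor s/2\rfloor\},\ j\in\{c_{2k},\dots,a'_{2k}\}\},$$ where $c_{2k}=b_{2k}$ if $k=t$ and $c_{2k}=1$ otherwise, $a'_{2k}=a_{2k}$ if $2k<s$ and $a'_s=N_s$; and $e(S)=1+a_{2t}-b_{2t}+\sum_{k=t+1}^{\lfloor (s-1)/2\rfloor}a_{2k}+\nu$.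
   Context: $\langle a,b\rangle=\{xa+yb:x,y\in\mathbb{N}\}$; $S/d=\{x\in\mathbb{N}:dx\in S\}$; $\mathrm{Irr}(S)$ is the minimal generating set of the numerical semigroup $S$ (nonzero elements not a sum of two nonzero elements) and $e(S)=\#\mathrm{Irr}(S)$. Continued fractions: a rational $\alpha\in(0,1)$ is written $\alpha=[0,a_1,\dots,a_r,1]$, i.e. its standard continued fraction expansion chosen so that its last partial quotient is $1$ ($a_i$ positive integers); with $a_0=0$, $p_{-2}=0,p_{-1}=1,q_{-2}=1,q_{-1}=0$ and $p_k=a_kp_{k-1}+p_{k-2}$, $q_k=a_kq_{k-1}+q_{k-2}$ for $k\in\{0,\dots,r\}$ the convergents are $p_k/q_k$, and $\alpha=p_{r+1}/q_{r+1}$ with $a_{r+1}=1$; $\delta_k=(-1)^k(q_k\alpha-p_k)$. $\alpha$-numeration: let $E_\alpha$ be the set of $(d_1,\dots,d_r)\in\mathbb{N}^r$ such that for every $j$, $d_j\in\{0,\dots,a_j\}$, and $d_j=0$ implies either $d_i=0$ for all $i\geqslant j$ or ($j\geqslant2$ and $d_{j-1}=a_{j-1}$). Every $n\in\{0,\dots,q_{r+1}-1\}$ has a unique representation $n=\sum_{j=1}^r d_jq_{j-1}$ with $(d_j)\in E_\alpha$, called its $\alpha$-numeration; every $\beta\in\{k/q_{r+1}:k\in\{0,\dots,q_{r+1}-1\}\}$ has a unique representation $\beta=\sum_{j=1}^r(-1)^{j-1}d_j\delta_{j-1}$ with $(d_j)\in E_\alpha$, called its $\alpha$-numeration (and $\{n\alpha\}$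 and $n$ have the same $\alpha$-numeration). Writing an $\alpha$-numeration as $(N_1,\dots,N_s)$ with $N_s>0$ means $s$ is the last index with a nonzero entry (later entries are $0$). *)

(* Defs.v *)
From mathcomp Require Import all_boot all_order all_algebra finmap.
From mathcomp Require Import boolp classical_sets functions cardinality.

Set Implicit Arguments.
Unset Strict Implicit.
Unset Printing Implicit Defensive.

Import Order.TTheory GRing.Theory Num.Theory.

Local Open Scope classical_set_scope.
Local Open Scope ring_scope.

Definition gen2 (a b : nat) : set nat :=
  [set n | exists x y : nat, n = (x * a + y * b)%N].

Definition sgquot (S : set nat) (d : nat) : set nat := [set x | S (d * x)%N].

Definition Irr (S : set nat) : set nat :=
  [set x | [/\ S x, x <> 0%N &
    ~ exists y z : nat, [/\ S y, S z, y <> 0%N, z <> 0%N & x = (y + z)%N]]].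

(* fset_set is the empty finite set on an infinite argument. *)
Definition embdim (S : set nat) : nat := #|` fset_set (Irr S)|%fset.

Fixpoint cf_val (s : seq nat) : rat :=
  match s with
  | [::] => 0
  | [:: x] => x%:R
  | x :: s' => x%:R + (cf_val s')^-1
  end.

(* c = [:: a_1; ...; a_r] encodes the expansion [0, a_1, ..., a_r, 1]. *)
Definition is_cf (alpha : rat) (c : seq nat) : Prop :=
  all (fun x => 0 < x)%N c /\ alpha = cf_val (0%N :: rcons c 1%N).

(* a_k, for 0 <= k <= r + 1 *)
Definition pquot (c : seq nat) (k : nat) : nat :=
  nth 0%N (0%N :: rcons c 1%N) k.

(* The recurrence u_k = a_k u_(k-1) + u_(k-2), with the index shifted by 2:
   cf_rec a u_(-2) u_(-1) (k + 2) = u_k. *)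
Fixpoint cf_rec (a : nat -> nat) (x y n : nat) : nat :=
  match n with
  | 0 => x
  | 1 => y
  | (n'.+1 as n1).+1 => (a n' * cf_rec a x y n1 + cf_rec a x y n')%N
  end.

Definition cf_p (c : seq nat) (k : nat) : nat := cf_rec (pquot c) 0 1 k.+2.
Definition cf_q (c : seq nat) (k : nat) : nat := cf_rec (pquot c) 1 0 k.+2.

Definition cf_delta (alpha : rat) (c : seq nat) (k : nat) : rat :=
  (-1) ^+ k * ((cf_q c k)%:R * alpha - (cf_p c k)%:R).

(* Digits are numbered from 1: the j-th entry of D = [:: d_1; ...; d_r] is
   dig D j, and dig D j = 0 for j outside 1..r. *)
Definition dig (D : seq nat) (j : nat) : nat := nth 0%N (0%N :: D) j.

Definition in_E (c D : seq nat) : Prop :=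
  size D = size c /\
  forall j : nat, (1 <= j <= size c)%N ->
    (dig D j <= pquot c j)%N /\
    (dig D j = 0%N ->
       (forall i : nat, (j <= i <= size c)%N -> dig D i = 0%N) \/
       ((2 <= j)%N /\ dig D j.-1 = pquot c j.-1)).

Definition numeration_nat (c : seq nat) (n : nat) (D : seq nat) : Prop :=
  in_E c D /\
  n = (\sum_(1 <= j < (size c).+1) dig D j * cf_q c j.-1)%N.

Definition numeration_rat (alpha : rat) (c : seq nat) (beta : rat)
    (D : seq nat) : Prop :=
  in_E c D /\
  beta = \sum_(1 <= j < (size c).+1)
           (-1) ^+ j.-1 * (dig D j)%:R * cf_delta alpha c j.-1.

Definition last_nonzero (D : seq nat) (s : nat) : Prop :=
  (0 < dig D s)%N /\ forall i : nat, (s < i)%N -> dig D i = 0%N.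

(* t = min {i > 0 : b_(2i+1) > 0} if this set is nonempty, and
   t = floor (s' / 2) otherwise. *)
Definition is_t (B : seq nat) (s' t : nat) : Prop :=
  [/\ (0 < t)%N, (0 < dig B (2 * t + 1))%N &
      forall i : nat, (0 < i < t)%N -> dig B (2 * i + 1) = 0%N] \/
  (forall i : nat, (0 < i)%N -> dig B (2 * i + 1) = 0%N) /\ t = (s' %/ 2)%N.

(* Main.v *)
Require Import Defs.
From mathcomp Require Import all_boot all_order all_algebra finmap.
From mathcomp Require Import boolp classical_sets functions cardinality.
From mathcomp Require Import zify ring.

(** The elements of [S] are the numbers [(u a + v b) / d] with [u, v >= 0] and
    [u = v m] modulo [d]; such pairs form the nonnegative part of a plane
    lattice, and two of them give the same element of [S] iff they differ by a
    multiple of [(b, -a)].  The minimal generators of the nonnegative part of the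
    lattice are [(d, 0)], [(m, 1)], the intermediate convergents of even index,
    and [(0, d)]: consecutive ones form a basis of the lattice, so there are no
    lattice points in the boxes they bound.  If [(x0, v0)] is the last of these
    generators with [v0 < a], then every point [(u, v)] with [0 < v < a] has
    [u >= x0]; hence a generator [(u, v)] with [v < a] becomes reducible in [S]
    exactly when [(u - b, v + a)] dominates [(x0, v0)], that is when
    [x0 + b <= u].  The four cases describe the generators with [v < a] and
    [u < x0 + b], the two cut-off points being read off the numerations of
    [a - 1] and of [(x0 + b - 1) / d]. *)

Set Implicit Arguments.
Unset Strict Implicit.
Unset Printing Implicit Defensive.

Import Order.TTheory GRing.Theory Num.Theory.

Local Open Scope classical_set_scope.
Local Open Scope ring_scope.

(** * Empty boxes and chains of lattice points *)

(** Without a conflict of signs, nonzero coefficients push one coordinate out of its range at once.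
    With opposite signs, nonnegativity of one coordinate forces the positive coefficient to
    dominate, and then the other coordinate is too large. *)
Lemma box_empty (q1 u1 q2 u2 x y : int) :
  0 <= q1 -> q1 < q2 -> u2 < u1 -> 0 < u1 ->
  0 <= x * q1 + y * q2 < q2 -> 0 <= x * u1 + y * u2 < u1 ->
  x = 0 /\ y = 0.
Proof.
move=> q1_ge0 lt_q lt_u u1_gt0 /andP[q_ge0 q_lt] /andP[u_ge0 u_lt].
have q2_gt0 : 0 < q2 by lia.
case: (ltrP 0 y) => y0; case: (ltrP x 0) => x0.
- exfalso; have lt_xy : - x < y.
    rewrite ltNge; apply/negP => le_yx.
    have : 0 <= (- x - y) * u1 by apply: mulr_ge0; lia.
    have : 0 < y * (u1 - u2) by apply: mulr_gt0; lia.
    by lia.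
  have : 0 <= (y - 1 + x) * q1 by apply: mulr_ge0; lia.
  have : 0 <= (y - 1) * (q2 - q1) by apply: mulr_ge0; lia.
  by lia.
- have : 0 <= (y - 1) * q2 by apply: mulr_ge0; lia.
  have : 0 <= x * q1 by apply: mulr_ge0; lia.
  by lia.
- have : 0 <= - y * q2 by apply: mulr_ge0; lia.
  have : 0 <= - x * q1 by apply: mulr_ge0; lia.
  have [y_eq0|y_neq0] := eqVneq y 0.
    move: u_ge0 u_lt q_ge0; rewrite y_eq0 !mul0r !addr0.
    have : 0 < - x * u1 by apply: mulr_gt0; lia.
    by lia.
  have : 0 < - y * q2 by apply: mulr_gt0; lia.
  by lia.
have [y_eq0|y_neq0] := eqVneq y 0.
  move: u_ge0 u_lt; rewrite y_eq0 !mul0r !addr0.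
  split=> //; have [//|x_neq0] := eqVneq x 0.
  have : 0 <= (x - 1) * u1 by apply: mulr_ge0; lia.
  by lia.
exfalso; have lt_yx : - y < x.
  rewrite ltNge; apply/negP => le_xy.
  have : 0 <= (- y - x) * q1 by apply: mulr_ge0; lia.
  have : 0 < - y * (q2 - q1) by apply: mulr_gt0; lia.
  by lia.
have : 0 <= (x - 1 + y) * u1 by apply: mulr_ge0; lia.
have : 0 < - y * (u1 - u2) by apply: mulr_gt0; lia.
by lia.
Qed.

Section Chains.

Variables d m : nat.

(* The lattice point (u, v) is encoded by (q, p): v = q and u = q m - p d. *)
Definition height (g : int * int) : int := g.1 * m%:Z - g.2 * d%:Z.

Lemma heightD g h : height (g + h) = height g + height h.
Proof. by rewrite /height /=; ring. Qed.

Lemma heightB g h : height (g - h) = height g - height h.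
Proof. by rewrite /height /=; ring. Qed.

(** The determinant 1, in the coordinates (q, p), makes [g] and [h] a basis of the lattice. *)
Definition step (g h : int * int) : bool :=
  [&& height h < height g, g.1 < h.1 & g.1 * h.2 - h.1 * g.2 == 1].

(** Cramer's rule with determinant 1 writes [x] as an integer combination of [g] and [h], to which
    [box_empty] applies. *)
Lemma step_box (g h x : int * int) : 0 <= g.1 -> 0 < height g -> step g h ->
  0 <= x.1 < h.1 -> 0 <= height x < height g -> x = 0.
Proof.
case: g h x => q1 p1 [q2 p2] [q p] /= q1_ge0 u1_gt0.
move=> /and3P[/= lt_u lt_q /eqP det1].
pose y := q * p2 - q2 * p; pose z := q1 * p - q * p1.
have qE : q = y * q1 + z * q2.
  rewrite -[LHS]mulr1 -det1 /y /z; ring.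
have pE : p = y * p1 + z * p2.
  rewrite -[LHS]mulr1 -det1 /y /z; ring.
have uE : height (q, p) = y * height (q1, p1) + z * height (q2, p2).
  rewrite /height /= {1}qE {1}pE; ring.
rewrite uE {1 2}qE => q_bd u_bd.
have [y0 z0] := box_empty q1_ge0 lt_q lt_u u1_gt0 q_bd u_bd.
by rewrite qE pE y0 z0 !mul0r.
Qed.

(** Points related by [below] are never comparable in the componentwise order, so a chain is an
    antichain there. *)
Definition below (g h : int * int) := (height h < height g) && (g.1 < h.1).

Lemma below_trans : transitive below.
Proof. by move=> g f h; rewrite /below; lia. Qed.

Lemma step_below (g : int * int) s : path step g s -> path below g s.
Proof. by apply: sub_path => x y /and3P[? ? _]; apply/andP. Qed.

Lemma chain_comparable (g : int * int) s (h h' : int * int) : path step g s ->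
  h \in g :: s -> h' \in g :: s -> [|| h == h', below h h' | below h' h].
Proof.
move/step_below; elim: s g => [|g' s IHs] g /=.
  by move=> _; rewrite !inE => /eqP-> /eqP->; rewrite eqxx.
move=> path_s; have /andP[_ path_s'] := path_s.
have /allP min_g : all (below g) (g' :: s).
  exact: (order_path_min below_trans (path_s : path below g (g' :: s))).
rewrite inE => /orP[/eqP->|h_s]; rewrite inE => /orP[/eqP->|h'_s].
- by rewrite eqxx.
- by rewrite min_g ?orbT.
- by rewrite min_g ?orbT.
- exact: IHs path_s' h_s h'_s.
Qed.

Lemma chain_last (g : int * int) s (h : int * int) : path step g s -> h \in g :: s ->
  height (last g s) <= height h /\ h.1 <= (last g s).1.
Proof.
elim: s g h => [|g' s IHs] g h /=.
  by rewrite inE => _ /eqP->.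
move=> /andP[/and3P[lt_u lt_q _] path_s]; rewrite inE => /orP[/eqP->|h_s].
  have [le_u le_q] := IHs g' g' path_s (mem_head _ _).
  by split; [apply: le_trans le_u (ltW lt_u) | apply: le_trans (ltW lt_q) le_q].
exact: IHs.
Qed.

Lemma chain_antichain (g : int * int) s (h h' : int * int) : path step g s ->
  h \in g :: s -> h' \in g :: s -> height h <= height h' -> h.1 <= h'.1 ->
  h = h'.
Proof.
move=> path_s h_s h'_s le_u le_q.
have /or3P[/eqP//||] := chain_comparable path_s h_s h'_s; rewrite /below; lia.
Qed.

(** If the first coordinate of [x] falls between two consecutive points, [step_box] puts [x] at
    least as high as the first of them. Beyond the last point the empty box of width [V] takes
    over. *)
Lemma chain_dominates (V : int) (g x : int * int) s :
  path step g s -> 0 <= g.1 ->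
  (forall x : int * int, 0 <= x.1 < V -> 0 <= height x < height (last g s) ->
     x = 0) ->
  g.1 <= x.1 < V -> 0 <= height x -> x != 0 ->
  exists2 h : int * int, h \in g :: s & height h <= height x /\ h.1 <= x.1.
Proof.
move=> path_s g_ge0 box qV u_ge0 nz.
elim: s g path_s g_ge0 box qV => [|g' s IHs] g /=.
  move=> _ g_ge0 box qV; exists g; rewrite ?mem_head //; split; last by lia.
  rewrite leNgt; apply/negP => lt_u; case/eqP: nz.
  by apply: box; [lia | rewrite u_ge0].
move=> /andP[st path_s] g_ge0 box qV.
have [lt_u lt_q _] := and3P st.
have [le_q|gt_q] := lerP g'.1 x.1.
  have g'_ge0 : 0 <= g'.1 by exact: le_trans g_ge0 (ltW lt_q).
  have qV' : g'.1 <= x.1 < V by rewrite le_q; case/andP: qV.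
  have [h h_s hP] := IHs g' path_s g'_ge0 box qV'.
  by exists h => //; rewrite inE h_s orbT.
exists g; rewrite ?mem_head //; split; last by lia.
rewrite leNgt; apply/negP => lt_ug; case/eqP: nz.
have u_gt0 : 0 < height g by exact: le_lt_trans u_ge0 lt_ug.
by apply: (step_box g_ge0 u_gt0 st); [lia | rewrite u_ge0].
Qed.

End Chains.

(** * Elements of the quotient semigroup as values of lattice points *)

Section QuotientSemigroup.

Variables (a b d m tau : nat).
Hypotheses (a_gt0 : (0 < a)%N) (b_gt0 : (0 < b)%N) (d_gt0 : (0 < d)%N).
Hypotheses (co_ab : coprime a b) (co_ad : coprime a d).
Hypothesis tauE : (tau * d = a * m + b)%N.

Local Notation height := (height d m).
Local Notation step := (step d m).
Local Notation S := (sgquot (gen2 a b) d).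

(* (u a + v b) / d, since tau d = a m + b *)
Definition value (g : int * int) : int := tau%:Z * g.1 - a%:Z * g.2.

Lemma value_height (g : int * int) : d%:Z * value g = a%:Z * height g + b%:Z * g.1.
Proof.
have tauEz : tau%:Z * d%:Z = a%:Z * m%:Z + b%:Z by lia.
rewrite /value /height mulrBr mulrA [d%:Z * tau%:Z]mulrC tauEz; ring.
Qed.

Lemma valueD g h : value (g + h) = value g + value h.
Proof. by rewrite /value /=; ring. Qed.

Lemma valueB g h : value (g - h) = value g - value h.
Proof. by rewrite /value /=; ring. Qed.

Lemma value_mem (g : int * int) : 0 <= g.1 -> 0 <= height g -> g != 0 ->
  exists x : nat, [/\ S x, x <> 0%N & x%:Z = value g].
Proof.
move=> q_ge0 u_ge0 nz; have vE := value_height g.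
have d_gt0z : 0 < d%:Z by [].
have sum_gt0 : 0 < a%:Z * height g + b%:Z * g.1.
  have := mulr_ge0 (ltW (a_gt0 : 0 < a%:Z)) u_ge0.
  have := mulr_ge0 (ltW (b_gt0 : 0 < b%:Z)) q_ge0.
  have [/eqP sum0|] := eqVneq (a%:Z * height g + b%:Z * g.1) 0; last by lia.
  rewrite paddr_eq0 ?mulr_ge0 // !mulf_eq0 in sum0.
  case/andP: sum0 => /orP[|/eqP u0]; first by lia.
  move=> /orP[|/eqP q0]; first by lia.
  case/eqP: nz; case: g q0 u0 {vE q_ge0 u_ge0} => q p /= ->.
  rewrite /height /= mul0r sub0r => /eqP; rewrite oppr_eq0 mulf_eq0.
  by case/orP => [/eqP->//|]; lia.
have v_gt0 : 0 < value g by rewrite -(pmulr_rgt0 _ d_gt0z) vE.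
exists `|value g|%N; split; [|by lia|by lia].
exists `|height g|%N, `|g.1|%N.
have E1 : `|value g|%N%:Z = value g by lia.
have E2 : `|height g|%N%:Z = height g by lia.
have E3 : `|g.1|%N%:Z = g.1 by lia.
have : (d * `|value g|)%N%:Z = (`|height g| * a + `|g.1| * b)%N%:Z.
  by rewrite PoszD !PoszM E1 E2 E3 vE; ring.
by move=> [].
Qed.

(** From [d x = u a + v b] and [tau d = a m + b] it follows that [d] divides [a (v m - u)]; as [a]
    and [d] are coprime, (u, v) is a lattice point. *)
Lemma mem_value x : S x ->
  exists g : int * int, [/\ 0 <= g.1 < a%:Z, 0 <= height g & value g = x%:Z].
Proof.
move=> [u [v duv]].
have duvz : d%:Z * x%:Z = u%:Z * a%:Z + v%:Z * b%:Z by lia.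
have tauEz : tau%:Z * d%:Z = a%:Z * m%:Z + b%:Z by lia.
have d_neq0 : d%:Z != 0 by lia.
have : (d%:Z %| a%:Z * (v%:Z * m%:Z - u%:Z))%Z.
  apply/dvdzP; exists (v%:Z * tau%:Z - x%:Z).
  rewrite mulrBl -mulrA tauEz [x%:Z * _]mulrC duvz; ring.
rewrite Gauss_dvdzr; last by rewrite /coprimez /gcdz /= eqz_nat gcdnC.
move=> /dvdzP[p pE].
pose k : nat := (v %/ a)%N.
have vE : v%:Z = k%:Z * a%:Z + (v %% a)%N%:Z.
  by rewrite -PoszM -PoszD -divn_eq.
(* Subtracting [k (a, tau)] reduces [v] modulo [a], keeps the value and adds [k b] to [u]. *)
exists ((v %% a)%N%:Z, p - k%:Z * tau%:Z); rewrite lez_nat ltz_nat ltn_mod a_gt0.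
set g := (_, _).
have uE : height g = u%:Z + k%:Z * b%:Z.
  rewrite /height /= mulrBl -pE -mulrA tauEz vE; ring.
split=> //; first by rewrite uE addr_ge0 // mulr_ge0.
apply: (mulfI d_neq0); rewrite value_height uE duvz vE /=; ring.
Qed.

Lemma coprime_a_tau : coprime a tau.
Proof.
have : coprime a (tau * d) by rewrite tauE -coprime_modr mulnC modnMDl coprime_modr.
by rewrite coprimeMr => /andP[].
Qed.

(** Since [a] and [tau] are coprime, [(a, tau)] generates the kernel of [value]; in the coordinates
    (u, v) it is the vector (-b, a). *)
Lemma value_eqE (g h : int * int) : value g = value h ->
  exists k : int, h = g + (k * a%:Z, k * tau%:Z).
Proof.
case: g h => q p [q' p'] eq_v.
have {}eq_v : tau%:Z * (q' - q) = a%:Z * (p' - p).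
  by move: eq_v; rewrite /value /=; lia.
have : (a%:Z %| tau%:Z * (q' - q))%Z by rewrite eq_v dvdz_mulr.
rewrite Gauss_dvdzr; last exact: coprime_a_tau.
move=> /dvdzP[k kE]; exists k; congr (_, _); first by rewrite /= -kE addrC subrK.
apply: (@mulfI _ a%:Z); first by lia.
have : a%:Z * (p' - p) = a%:Z * (k * tau%:Z) by rewrite -eq_v kE; ring.
by move=> E; rewrite /= mulrDr -E; ring.
Qed.

Lemma value_inj (g h : int * int) : 0 <= g.1 < a%:Z -> 0 <= h.1 < a%:Z ->
  value g = value h -> g = h.
Proof.
move=> g_bd h_bd /value_eqE[k hE].
have [k0|k_neq0] := eqVneq k 0; first by rewrite hE k0 !mul0r addr0.
exfalso; move: h_bd; rewrite hE /= => h_bd.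
have [k_gt0|k_le0] := ltrP 0 k.
  have : 0 <= (k - 1) * a%:Z by apply: mulr_ge0; lia.
  by lia.
have : 0 <= (- k - 1) * a%:Z by apply: mulr_ge0; lia.
by lia.
Qed.

(** * Irreducible elements read off a chain *)

Section Irreducibles.

(** This encodes the lattice point (u, v) = (d, 0), whose value is [a]. *)
Let g0 : int * int := (0, -1).
Variable s : seq (int * int).
Let g1 := last g0 s.
Hypothesis path_s : path step g0 s.
Hypothesis g1_bd : g1.1 < a%:Z.
Hypothesis g1_ge0 : 0 <= height g1.
Hypothesis box : forall x : int * int,
  0 <= x.1 < a%:Z -> 0 <= height x < height g1 -> x = 0.

Lemma height_g0 : height g0 = d%:Z.
Proof. by rewrite /height /=; ring. Qed.

Lemma chain_bounds (h : int * int) : h \in g0 :: s ->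
  [/\ 0 <= h.1 < a%:Z, 0 <= height h, height g1 <= height h & h != 0].
Proof.
move=> h_s; have [le_u le_q] := chain_last path_s h_s.
have h_ge0 : 0 <= h.1.
  have /or3P[/eqP->//||] := chain_comparable path_s h_s (mem_head _ _).
    move=> /andP[_ lt_q]; have := order_path_min (@below_trans d m) (step_below path_s).
    move: h_s; rewrite inE => /orP[/eqP->//|h_s] /allP/(_ _ h_s) /andP[_].
    by move/ltW.
  by move=> /andP[_ /ltW].
have u_ge0 := le_trans g1_ge0 le_u.
split=> //; first by rewrite h_ge0 (le_lt_trans le_q).
apply/eqP=> h0; move: h_s u_ge0; rewrite h0 => h_s _.
have : (0 : int * int) = g0.
  apply: (chain_antichain path_s h_s (mem_head _ _)) => //.
  by rewrite height_g0 /height /= !mul0r.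
by [].
Qed.

(** The representative [g] of an irreducible element dominates a chain point [h], and [g - h] must
    vanish, as it would otherwise be a second summand. The bound on the height excludes the
    splittings that appear only after a translation by the kernel vector. *)
Lemma Irr_chainP (x : nat) : Irr S x <->
  exists2 h : int * int, h \in g0 :: s & height h < height g1 + b%:Z /\ value h = x%:Z.
Proof.
split.
  case=> /mem_value[g [g_bd u_ge0 vE]] x_neq0 irr.
  have g_nz : g != 0.
    by apply/eqP=> gz; apply: x_neq0; move: vE; rewrite gz /value /= !mulr0; lia.
  have [q_ge0 q_lt] := andP g_bd.
  have [h h_s [le_u le_q]] :=
    chain_dominates path_s (lexx 0) box g_bd u_ge0 g_nz.
  have [h_bd uh_ge0 u_last h_nz] := chain_bounds h_s.
  have [q0 qa] := andP h_bd.
  have [y [Sy y_nz yE]] := value_mem q0 uh_ge0 h_nz.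
  have gh : g = h.
    apply/eqP; rewrite -subr_eq0; apply/negPn/negP => nz.
    have [| |z [Sz z_nz zE]] := value_mem _ _ nz.
    - by rewrite /= subr_ge0.
    - by rewrite heightB subr_ge0.
    apply: irr; exists y, z; split=> //.
    by move: zE; rewrite valueB vE -yE; lia.
  exists h => //; split; last by rewrite -gh.
  rewrite ltNge; apply/negP => big_u.
  have g1_s : g1 \in g0 :: s by exact: mem_last.
  have [g1_bd' _ _ g1_nz] := chain_bounds g1_s.
  have [q1_ge0 q1_lt] := andP g1_bd'.
  have [w [Sw w_nz wE]] := value_mem q1_ge0 g1_ge0 g1_nz.
  have tauEz : tau%:Z * d%:Z = a%:Z * m%:Z + b%:Z by lia.
  have kerE : height (a%:Z, tau%:Z) = - b%:Z by rewrite /height /= tauEz; ring.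
  (* This translate of [h] has the same value and dominates [g1], strictly in the first coordinate,
     so [g1] splits off. *)
  have [| | |z [Sz z_nz zE]] := @value_mem (h + (a%:Z, tau%:Z) - g1).
  - by move: q0 q1_lt; rewrite /=; lia.
  - by rewrite heightB heightD kerE; lia.
  - apply/eqP=> /(congr1 fst) /=; move: q0 q1_lt; lia.
  apply: irr; exists w, z; split=> //.
  have ker0 : value (a%:Z, tau%:Z) = 0 by rewrite /value /=; ring.
  by move: zE; rewrite valueB valueD ker0 -gh vE -wE; lia.
move=> [h h_s [small_u vE]].
have [h_bd uh_ge0 u_last h_nz] := chain_bounds h_s.
have [q0 qa] := andP h_bd.
have [x' [Sx' x'_nz x'E]] := value_mem q0 uh_ge0 h_nz.
have xx' : x' = x by move: x'E; rewrite vE => -[].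
rewrite xx' in Sx' x'_nz; split=> // -[y [z [Sy Sz y_nz z_nz xE]]].
have [gy [gy_bd uy_ge0 vy]] := mem_value Sy.
have [gz [gz_bd uz_ge0 vz]] := mem_value Sz.
have gy_nz : gy != 0.
  by apply/eqP=> E; apply: y_nz; move: vy; rewrite E /value /= !mulr0; lia.
have [g g_s [le_u le_q]] :=
  chain_dominates path_s (lexx 0) box gy_bd uy_ge0 gy_nz.
have [_ _ ug _] := chain_bounds g_s.
have sumE : value h = value (gy + gz).
  by rewrite valueD vy vz vE xE PoszD.
have [k kE] := value_eqE sumE.
have qE : gy.1 + gz.1 = h.1 + k * a%:Z by move/(congr1 fst): kE.
have uE : height gy + height gz = height h - k * b%:Z.
  have tauEz : tau%:Z * d%:Z = a%:Z * m%:Z + b%:Z by lia.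
  rewrite -heightD kE heightD; congr (_ + _).
  rewrite /height /= -!mulrA tauEz; ring.
(* A negative [k] would make the first coordinate of [gy + gz] negative. For [k = 0] the chain point
   under [gy] lies under [h] too, hence equals [h], which leaves [gz = 0]. *)
have [k_le0|k_gt0] := lerP k 0.
  have k0 : k = 0.
    have [//|k_neq0] := eqVneq k 0.
    have : 0 <= (- k - 1) * a%:Z by apply: mulr_ge0; lia.
    by move: gy_bd gz_bd => /=; lia.
  rewrite k0 !mul0r ?subr0 ?addr0 in qE uE.
  have gh : g = h.
    apply: (chain_antichain path_s g_s h_s).
      by apply: le_trans le_u _; rewrite -uE lerDl.
    by apply: le_trans le_q _; rewrite -qE lerDl; case/andP: gz_bd.
  have : gz = 0.
    have uz0 : height gz = 0 by rewrite gh in le_u; lia.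
    have qz0 : gz.1 = 0 by rewrite gh in le_q; move: gz_bd; lia.
    case: gz uz0 qz0 {vz gz_bd uz_ge0 sumE kE qE uE} => q p uz0 /= q0'.
    move: uz0; rewrite /height /= q0' mul0r sub0r => /eqP.
    rewrite oppr_eq0 mulf_eq0 => /orP[/eqP->//|]; lia.
  by move=> E; apply: z_nz; move: vz; rewrite E /value /= !mulr0; lia.
(* For [k > 0] the height of [gy] is at most [height h - b], hence below [height g1], although [gy]
   dominates a chain point. *)
have : 0 <= (k - 1) * b%:Z by apply: mulr_ge0; lia.
by lia.
Qed.

(** First coordinates on the chain lie in [[0, a)], where [value] is injective; so the list of
    values has no repetition and its size counts the irreducibles. *)
Lemma Irr_chain (L : seq int) :
  perm_eq L [seq value h | h <- g0 :: s & height h < height g1 + b%:Z] ->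
  [/\ uniq L, Posz @` Irr S = [set` L] & embdim S = size L].
Proof.
move=> permL.
have uniqL : uniq L.
  rewrite (perm_uniq permL) map_inj_in_uniq.
    apply/filter_uniq/(sorted_uniq (@below_trans d m)); last exact: step_below.
    by move=> g; rewrite /below ltxx.
  move=> g h; rewrite !mem_filter => /andP[_ g_s] /andP[_ h_s].
  have [? _ _ _] := chain_bounds g_s; have [? _ _ _] := chain_bounds h_s.
  exact: value_inj.
have IrrE : Posz @` Irr S = [set` L].
  apply/seteqP; split=> [_ [x /Irr_chainP[h h_s [lt_u vE]] <-]|x] /=.
    rewrite (perm_mem permL) -vE; apply: map_f.
    by rewrite mem_filter h_s andbT.
  rewrite (perm_mem permL) => /mapP[h]; rewrite mem_filter => /andP[lt_u h_s] ->.
  have [h_bd uh_ge0 _ h_nz] := chain_bounds h_s; have [q0 _] := andP h_bd.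
  have [y [Sy y_nz yE]] := value_mem q0 uh_ge0 h_nz.
  by exists y => //; apply/Irr_chainP; exists h.
split=> //; rewrite /embdim.
have IrrE' : Irr S = [set` [fset absz x | x in L]%fset].
  apply/seteqP; split=> [x Ix|x] /=.
    apply/imfsetP; exists x%:Z => //=.
    by have : (Posz @` Irr S) x%:Z by [exists x]; rewrite IrrE.
  move=> /imfsetP[y /= yL ->].
  have : (Posz @` Irr S) y by rewrite IrrE.
  by move=> [z Iz <-].
rewrite IrrE' set_fsetK card_in_imfset /=; last first.
  move=> y z yL zL.
  have : (Posz @` Irr S) y by rewrite IrrE.
  have : (Posz @` Irr S) z by rewrite IrrE.
  by move=> [z' _ <-] [y' _ <-] /= ->.
by rewrite undup_id.
Qed.

End Irreducibles.

End QuotientSemigroup.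

(** * Continued fractions: convergents and their errors *)

Lemma cf_val_cons x s : s != [::] -> cf_val (x :: s) = x%:R + (cf_val s)^-1.
Proof. by case: s. Qed.

Lemma cf_val_gt0 s : s != [::] -> all (fun x => 0 < x)%N s -> 0 < cf_val s.
Proof.
elim: s => // x s IHs _ /andP[x_gt0 s_gt0].
have [->|s_nil] := eqVneq s [::]; first by rewrite /= ltr0n.
by rewrite cf_val_cons // ltr_wpDl ?ler0n // invr_gt0 IHs.
Qed.

Lemma index_iota1S n : index_iota 1 n.+2 = rcons (index_iota 1 n.+1) n.+1.
Proof. by rewrite /index_iota !subn1 -cats1 -[n.+2.-1]addn1 iotaD. Qed.

Section Convergents.

Variables (d m : nat) (c : seq nat).
Hypotheses (d_gt0 : (0 < d)%N) (m_gt0 : (0 < m)%N) (lt_md : (m < d)%N).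
Hypotheses (co_md : coprime m d) (cf_c : is_cf (m%:R / d%:R) c).

Local Notation r := (size c).
Local Notation A := (pquot c).

(* Indices are shifted by 2, as in [cf_rec]: [Q n] is q_(n-2). *)
Definition cvgq (n : nat) : nat := cf_rec A 1 0 n.
Definition cvgp (n : nat) : nat := cf_rec A 0 1 n.
Local Notation Q := cvgq.
Local Notation P := cvgp.
Arguments cvgq : simpl never.
Arguments cvgp : simpl never.

(* d * delta_(n-2) *)
Definition cvge (n : nat) : int := (-1) ^+ n * ((Q n)%:Z * m%:Z - (P n)%:Z * d%:Z).
Local Notation E := cvge.

Lemma cvgq_rec n : Q n.+2 = (A n * Q n.+1 + Q n)%N. Proof. by []. Qed.
Lemma cvgp_rec n : P n.+2 = (A n * P n.+1 + P n)%N. Proof. by []. Qed.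

Lemma cvge_rec n : E n = (A n)%:Z * E n.+1 + E n.+2.
Proof.
by rewrite /E cvgq_rec cvgp_rec !exprS !PoszD !PoszM; ring.
Qed.

Lemma cvg_det n : (Q n)%:Z * (P n.+1)%:Z - (Q n.+1)%:Z * (P n)%:Z = (-1) ^+ n.
Proof.
elim: n => [|n IHn]; first by rewrite expr0.
rewrite cvgq_rec cvgp_rec exprS -IHn !PoszD !PoszM; ring.
Qed.

(** Eliminating [m] between two consecutive errors leaves [d] times the determinant. *)
Lemma cvge_cvgq n : E n * (Q n.+1)%:Z + E n.+1 * (Q n)%:Z = d%:Z.
Proof.
have sgn2 : (-1 : int) ^+ n * (-1) ^+ n = 1 by rewrite -expr2 sqrr_sign.
transitivity ((-1 : int) ^+ n * (-1) ^+ n * d%:Z); last by rewrite sgn2 mul1r.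
by rewrite -{2}cvg_det /E exprS; ring.
Qed.

Lemma pquot_gt0 k : (0 < k <= r.+1)%N -> (0 < A k)%N.
Proof.
case: k => // k /andP[_ le_kr]; rewrite /pquot /= nth_rcons.
have [lt_kr|ge_kr] := ltnP k r; last by rewrite ifT; lia.
by case: cf_c => /all_nthP-> //.
Qed.

Lemma cvgq_gt0 n : (1 < n)%N -> (0 < Q n)%N.
Proof.
suff H k : (0 < Q k.+2)%N && (0 < Q k.+3)%N by case: n => [|[|n]] // _; case/andP: (H n).
elim: k => [|k /andP[H1 H2]]; last by rewrite H2 cvgq_rec addn_gt0 H1 orbT.
by rewrite !cvgq_rec /= muln1 addn0 pquot_gt0 //=; lia.
Qed.

(** The complete quotient with partial quotients a_(k+1), ..., a_r, 1. *)
Let T k : rat := cf_val (drop k (rcons c 1%N)).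

Let T_gt0 k : (k <= r)%N -> 0 < T k.
Proof.
move=> le_kr; apply: cf_val_gt0.
  by rewrite -size_eq0 size_drop size_rcons subn_eq0 -ltnNge ltnS.
apply/allP => x /mem_drop; rewrite mem_rcons inE => /orP[/eqP->//|].
by case: cf_c => /allP H _ /H.
Qed.

Let T_rec k : (k < r)%N -> T k = (A k.+1)%:R + (T k.+1)^-1.
Proof.
move=> lt_kr; rewrite /T (drop_nth 0%N) ?size_rcons; last by lia.
by rewrite cf_val_cons // -size_eq0 size_drop size_rcons subn_eq0 -ltnNge.
Qed.

Let ratZ (x : int) : rat := x%:~R.

Lemma cvge1 : E 1 = d%:Z.
Proof. by rewrite /E expr1 mul0r sub0r mulN1r opprK mul1r. Qed.

Lemma cvge2 : E 2 = m%:Z.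
Proof. by rewrite /E sqrrN expr1n mul1r mul0r subr0 mul1r. Qed.

(** Induction from [d = m * T 0]: both [cvge_rec] and [T_rec] peel off the same partial quotient. *)
Let E_T k : (k <= r)%N -> ratZ (E k.+1) = ratZ (E k.+2) * T k.
Proof.
elim: k => [_|k IHk lt_kr].
  have [_] := cf_c; rewrite cf_val_cons; last by case: (c).
  rewrite add0r cvge1 cvge2 -[rcons c _]drop0 -/(T 0) => /(canRL (mulfVK _)) md.
  have T0 : T 0 != 0 by rewrite gt_eqF ?T_gt0.
  rewrite /ratZ -!pmulrn md ?pnatr_eq0 -?lt0n // mulrAC mulVf ?mul1r //.
have T1 : T k.+1 != 0 by rewrite gt_eqF ?T_gt0.
have := IHk (ltnW lt_kr); rewrite (T_rec lt_kr).
rewrite [E k.+1]cvge_rec /ratZ rmorphD rmorphM /= mulrDr mulrC => /addrI ->.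
by rewrite mulfVK.
Qed.

Lemma cvge_gt0 n : (0 < n <= r.+2)%N -> 0 < E n.
Proof.
elim: n => // -[_ _|n IHn le_nr]; first by rewrite cvge1.
have /IHn : (0 < n.+1 <= r.+2)%N by lia.
rewrite -(ltr0z rat) -/(ratZ _) E_T; last by lia.
by rewrite pmulr_lgt0 ?T_gt0 ?ltr0z //; lia.
Qed.

(** The last complete quotient is 1, so the two errors agree and [E r.+3] vanishes. Coprimality then
    makes [d] divide [Q r.+3], and [cvge_cvgq] forces [E r.+2 = 1]. *)
Lemma cvge_last : E r.+1 = 1 /\ E r.+2 = 1.
Proof.
have TrE : T r = 1 by rewrite /T drop_rcons ?leqnn // drop_size.
have e1 : E r.+1 = E r.+2.
  by apply: (@intr_inj rat); rewrite [LHS](E_T (leqnn _)) TrE mulr1.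
have Ar : A r.+1 = 1%N by rewrite /pquot /= nth_rcons ltnn eqxx.
have e3 : E r.+3 = 0.
  by have := cvge_rec r.+1; rewrite Ar e1 mul1r => /eqP; rewrite -subr_eq0; lia.
have Qm : (Q r.+3 * m = P r.+3 * d)%N.
  have : (Q r.+3)%:Z * m%:Z - (P r.+3)%:Z * d%:Z = 0.
    by apply: (@mulfI _ ((-1) ^+ r.+3)); rewrite ?signr_eq0 // mulr0 -/(E _).
  lia.
have /dvdnP[j jE] : (d %| Q r.+3)%N.
  by rewrite -(@Gauss_dvdl _ _ m) 1?coprime_sym // Qm dvdn_mull.
have := cvge_cvgq r.+2; rewrite e3 mul0r addr0 jE PoszM => ed.
have E_gt0 : 0 < E r.+2 by apply: cvge_gt0; rewrite leqnn.
suff : E r.+2 = 1 by rewrite e1.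
have : E r.+2 * j%:Z = 1.
  by apply: (@mulIf _ d%:Z); [lia | rewrite -mulrA ed mul1r].
case: (E r.+2) E_gt0 => // e _ /eqP; rewrite -PoszM eqz_nat muln_eq1.
by case/andP=> /eqP->.
Qed.

Lemma cvge_even_le j k : (0 < j <= k)%N -> (2 * k <= r.+3)%N ->
  E (2 * k) <= E (2 * j).
Proof.
move=> /andP[j_gt0]; elim: k => [|k IHk]; first by lia.
rewrite leq_eqVlt => /orP[/eqP->//|]; rewrite ltnS => le_jk le_kr.
apply: le_trans (IHk le_jk _); last by lia.
rewrite mulnS [E (2 * k)]cvge_rec lerDr mulr_ge0 // ltW //.
by apply: cvge_gt0; lia.
Qed.

(** * Intermediate convergents of even index as a chain *)

(** With unshifted indices the first coordinate is q_(2k-2) + j q_(2k-1). *)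
Definition hpt (k j : nat) : int * int :=
  ((Q (2 * k) + j * Q (2 * k).+1)%N%:Z, (P (2 * k) + j * P (2 * k).+1)%N%:Z).

Definition block (k n : nat) := [seq hpt k j | j <- index_iota 1 n.+1].

(** Blocks start at [j = 1] because, by [hpt_next], [hpt k.+1 0] already ends block [k]; the initial
    point [hpt 1 0] is added separately. *)
Definition chain (K : nat) :=
  [seq hpt k j | k <- index_iota 1 K.+1, j <- index_iota 1 (A (2 * k)).+1].

Lemma height_hpt k j :
  height d m (hpt k j) = E (2 * k) - j%:Z * E (2 * k).+1.
Proof.
rewrite /height /E exprS exprM sqrrN !expr1n /= !PoszD !PoszM; ring.
Qed.

Lemma hpt_next k : hpt k (A (2 * k)) = hpt k.+1 0.
Proof.
rewrite /hpt mulnS !addn0 cvgq_rec cvgp_rec.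
by rewrite ![(Q _ + _)%N]addnC ![(P _ + _)%N]addnC.
Qed.

Lemma hpt10 : hpt 1 0 = (1, 0). Proof. by []. Qed.

(** The determinant does not depend on [j]: it is that of two consecutive convergents. *)
Lemma step_hpt k j : (0 < k)%N -> ((2 * k).+1 <= r.+2)%N ->
  step d m (hpt k j) (hpt k j.+1).
Proof.
move=> k_gt0 le_kr; have E_gt0 : 0 < E (2 * k).+1 by apply: cvge_gt0.
have Q_gt0 : (0 < Q (2 * k).+1)%N by apply: cvgq_gt0; lia.
have det : (Q (2 * k))%:Z * (P (2 * k).+1)%:Z - (Q (2 * k).+1)%:Z * (P (2 * k))%:Z = 1.
  by rewrite cvg_det exprM sqrrN !expr1n.
apply/and3P; split.
- by rewrite !height_hpt; lia.
- by rewrite /=; lia.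
apply/eqP; rewrite -[RHS]det /= !PoszD !PoszM; ring.
Qed.

Lemma blockS k n : block k n.+1 = rcons (block k n) (hpt k n.+1).
Proof. by rewrite /block index_iota1S map_rcons. Qed.

Lemma last_block k n : last (hpt k 0) (block k n) = hpt k n.
Proof. by case: n => // n; rewrite blockS last_rcons. Qed.

Lemma path_block k n : (0 < k)%N -> ((2 * k).+1 <= r.+2)%N ->
  path (step d m) (hpt k 0) (block k n).
Proof.
move=> k_gt0 le_kr; elim: n => // n IHn.
by rewrite blockS rcons_path IHn last_block step_hpt.
Qed.

Lemma chainS K : chain K.+1 = chain K ++ block K.+1 (A (2 * K.+1)).
Proof. by rewrite /chain index_iota1S -cats1 map_cat flatten_cat /= cats0. Qed.

Lemma last_chain K : last (hpt 1 0) (chain K) = hpt K.+1 0.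
Proof. by elim: K => // K IHK; rewrite chainS last_cat IHK last_block hpt_next. Qed.

Lemma path_chain K : (2 * K <= r.+1)%N -> path (step d m) (hpt 1 0) (chain K).
Proof.
elim: K => // K IHK le_Kr.
by rewrite chainS cat_path last_chain IHK ?path_block //; lia.
Qed.

Lemma step_hpt10 : step d m (0, -1) (hpt 1 0).
Proof.
apply/and3P; split=> //.
have -> : height d m (0, -1) = d%:Z by rewrite /height /=; ring.
by rewrite height_hpt muln1 cvge2 mul0r subr0 ltz_nat.
Qed.

(** * Bounds from numerations *)

Lemma in_E_size D j : in_E c D -> (0 < dig D j)%N -> (0 < j <= r)%N.
Proof.
case: j => // j [szD _]; rewrite /dig /= => Dj.
by rewrite -szD ltnNge; apply/negP => /(nth_default 0%N) E0; rewrite E0 in Dj.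
Qed.

Lemma dig_le D j : in_E c D -> (dig D j <= A j)%N.
Proof.
move=> DE; have [->//|] := posnP (dig D j).
by move=> /(in_E_size DE) /(proj2 DE)[].
Qed.

Lemma in_E_zero D j i : in_E c D -> (0 < j)%N -> dig D j = 0%N ->
  (j <= i)%N -> (0 < dig D i)%N -> (2 <= j)%N /\ dig D j.-1 = A j.-1.
Proof.
move=> DE j_gt0 Dj le_ji Di; have i_bd := in_E_size DE Di.
have j_bd : (0 < j <= r)%N by rewrite j_gt0 (leq_trans le_ji) //; case/andP: i_bd.
have [_ /(_ Dj) [D0|//]] := proj2 DE j j_bd.
by rewrite D0 // in Di; rewrite le_ji; case/andP: i_bd.
Qed.

(** The digits before [s] contribute at least q_(s-2) and less than q_(s-2) + q_(s-1). For
    [n = a - 1] this places [a] among the denominators of intermediate convergents. *)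
Lemma numeration_nat_bounds n D s : numeration_nat c n D -> last_nonzero D s ->
  [/\ (0 < s <= r)%N, (0 < dig D s <= A s)%N
    & (Q s + dig D s * Q s.+1 <= n < Q s + (dig D s).+1 * Q s.+1)%N].
Proof.
move=> [DE nE] [Ds Dgt]; have s_bd := in_E_size DE Ds.
split=> //; first by rewrite Ds dig_le.
pose W i := (\sum_(1 <= j < i.+1) dig D j * Q j.+1)%N.
have WS i : W i.+1 = (W i + dig D i.+1 * Q i.+2)%N by rewrite /W big_nat_recr.
have W0 : W 0%N = 0%N by rewrite /W big_nil.
have W_ub i : (W i < Q i.+2 + Q i.+1)%N.
  elim: i => [|i IHi]; first by rewrite W0.
  have : (dig D i.+1 * Q i.+2 <= A i.+1 * Q i.+2)%N by rewrite leq_mul2r dig_le ?orbT.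
  rewrite WS [Q i.+3]cvgq_rec; lia.
have W_lb i : (i < s)%N -> (Q i.+1 <= W i)%N.
  elim/ltn_ind: i => -[|i] IHi lt_is; first by rewrite W0.
  have [Di|Di] := posnP (dig D i.+1); last first.
    by rewrite WS; apply: leq_trans (leq_addl _ _); rewrite leq_pmull.
  (* A zero digit follows a full one, so the recurrence of [Q] carries the bound over from two
     indices earlier. *)
  have [i_gt0 Di1] := in_E_zero DE (ltn0Sn i) Di (ltnW lt_is) Ds.
  case: i => [|i] //= in IHi lt_is Di i_gt0 Di1 *.
  rewrite WS Di mul0n addn0 WS Di1 cvgq_rec addnC leq_add2r.
  by apply: IHi => //; lia.
have -> : n = W s.
  rewrite nE /W (@big_cat_nat _ _ _ s.+1) //=; last by case/andP: s_bd.
  rewrite [X in (_ + X)%N]big1_seq ?addn0; last first.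
    by move=> j; rewrite mem_index_iota => /andP[_ /andP[/Dgt-> _]].
  by apply: eq_big_nat => -[|j].
case: s s_bd Ds Dgt W_lb => // s _ Ds _ W_lb.
rewrite WS; have := W_ub s; have := W_lb s (ltnSn s); lia.
Qed.

(* (-1)^i d times the part of the alpha-numeration with digits of index > i *)
Definition tail (B : seq nat) (i : nat) : int :=
  \sum_(i <= j < r) (-1) ^+ (j - i) * (dig B j.+1)%:Z * E j.+2.

Lemma tail_ge B i : (r <= i)%N -> tail B i = 0.
Proof. by move=> ge_ir; rewrite /tail big_geq. Qed.

Lemma tail_rec B i : in_E c B ->
  tail B i = (dig B i.+1)%:Z * E i.+2 - tail B i.+1.
Proof.
move=> BE; have [ge_ir|lt_ir] := leqP r i.
  have [->|Bi] := posnP (dig B i.+1); first by rewrite !tail_ge ?mul0r ?subr0 // ltnW.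
  by have /andP[_] := in_E_size BE Bi; rewrite ltnNge ge_ir.
rewrite /tail big_ltn // subnn expr0 mul1r; congr (_ + _).
rewrite -sumrN; apply: eq_big_nat => j /andP[lt_ij _].
by rewrite -(subnSK lt_ij) exprS mulN1r !mulNr.
Qed.

(** Descending induction on [i], run on [k = r - i]: the digit lies between 0 and a_(i+1), and
    [cvge_rec] turns the bounds at [i + 1] into those at [i]. *)
Lemma tail_bounds B i : in_E c B -> (i <= r)%N -> - E i.+2 < tail B i < E i.+1.
Proof.
move=> BE le_ir; rewrite -(subKn le_ir); move: (r - i)%N (leq_subr i r) => k.
elim: k => [|k IHk] le_kr.
  rewrite subn0 tail_ge // oppr_lt0 !cvge_gt0 //; lia.
have := IHk (ltnW le_kr); rewrite -(subnSK le_kr); set n := (r - k.+1)%N => tl_bd.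
have le_nr : (n < r)%N by rewrite /n; lia.
have E_gt0 : 0 < E n.+2 by apply: cvge_gt0 => //; lia.
rewrite (tail_rec _ BE) [E n.+1]cvge_rec.
have le_xy := dig_le n.+1 BE.
have : 0 <= (dig B n.+1)%:Z * E n.+2 by rewrite mulr_ge0 // ltW.
have : 0 <= ((A n.+1)%:Z - (dig B n.+1)%:Z) * E n.+2.
  by rewrite mulr_ge0 ?subr_ge0 ?lez_nat // ltW.
by lia.
Qed.

Lemma tail_gt0 B i : in_E c B -> (0 < dig B i.+1)%N -> 0 < tail B i.
Proof.
move=> BE Bi; have := in_E_size BE Bi => /andP[_ lt_ir].
rewrite (tail_rec i BE); have := tail_bounds BE lt_ir.
have E_gt0 : 0 < E i.+2 by apply: cvge_gt0 => //; lia.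
have : 0 <= ((dig B i.+1)%:Z - 1) * E i.+2.
  by rewrite mulr_ge0 ?subr_ge0 ?lez_nat // ltW.
by lia.
Qed.

(** The first digit must be 1. At the indices 2i+1 with 0 < i < t the digits vanish, so the even
    digits before them are full and turn [E (2 * i)] into [E (2 * i.+1)]. What remains is
    [E (2 * t) - b_(2t) E (2 * t).+1] plus a tail in [[0, E (2 * t).+1)]. *)
Lemma numeration_rat_bounds B s' t : in_E c B -> last_nonzero B s' ->
  is_t B s' t -> tail B 0 < m%:Z ->
  [/\ (0 < t)%N, (2 * t <= r)%N, (0 < dig B (2 * t) <= A (2 * t))%N
    & E (2 * t) - (dig B (2 * t))%:Z * E (2 * t).+1 <= tail B 0
        < E (2 * t) - ((dig B (2 * t))%:Z - 1) * E (2 * t).+1].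
Proof.
move=> BE [Bs Bgt] t_def lt_Xm; have s_bd := in_E_size BE Bs.
have B1 : dig B 1 = 1%N.
  have B1_gt0 : (0 < dig B 1)%N.
    rewrite lt0n; apply/eqP => B1.
    by have [] := in_E_zero BE (ltn0Sn 0) B1 (proj1 (andP s_bd)) Bs.
  have le_1r : (1 <= r)%N by lia.
  have tl := tail_bounds BE le_1r; rewrite cvge2 in tl.
  have [|B1_gt1] := leqP (dig B 1) 1; first by lia.
  have : 0 <= ((dig B 1)%:Z - 2) * m%:Z by rewrite mulr_ge0 // subr_ge0 lez_nat.
  by move: lt_Xm tl; rewrite (tail_rec 0 BE) cvge2; lia.
have XE : tail B 0 = E 2 - tail B 1 by rewrite (tail_rec 0 BE) B1 mul1r.
have [t_gt0 Bmid nzt tl_ge0] :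
  [/\ (0 < t)%N, forall i, (0 < i < t)%N -> dig B (2 * i).+1 = 0%N,
      exists2 i, (2 * t <= i)%N & (0 < dig B i)%N & 0 <= tail B (2 * t)].
  case: t_def => [[t_gt0 Bt Bmid]|[B0 tE]].
    rewrite addn1 in Bt; split=> //; last exact/ltW/tail_gt0.
      by move=> i /Bmid; rewrite addn1.
    by exists (2 * t).+1; rewrite ?leqnSn.
  (* The last nonzero index is even: odd indices above 1 carry zeros, and [s' = 1] would give
     [tail B 0 = m]. *)
  have s'E : s' = (2 * t)%N.
    have := odd_double_half s'; rewrite tE divn2 -mul2n.
    case: (odd s') => /= sE; last by lia.
    have [h0|h_gt0] := posnP s'./2.
      have s1 : s' = 1%N by lia.
      have : tail B 1 = 0.
        rewrite /tail big1_seq // => j; rewrite mem_index_iota => /andP[_ /andP[j1 _]].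
        by rewrite Bgt ?mulr0 ?mul0r // s1.
      by move=> E0; move: lt_Xm; rewrite XE E0 cvge2; lia.
    by move: Bs; rewrite -sE addnC B0.
  split.
  - by lia.
  - by move=> i /andP[i_gt0 _]; rewrite -addn1 B0.
  - by exists s' => //; rewrite s'E.
  rewrite /tail big1_seq // => j; rewrite mem_index_iota => /andP[_ /andP[j1 _]].
  by rewrite Bgt ?mulr0 ?mul0r // s'E ltnS.
have Xinv k : (0 < k <= t)%N -> tail B 0 = E (2 * k) - tail B (2 * k).-1.
  elim: k => // -[_ _|k IHk lt_kt]; first by rewrite muln1 XE.
  have -> : (2 * k.+2 = (2 * k.+1).+2)%N by lia.
  have Bk : dig B (2 * k.+1).+1 = 0%N by apply: Bmid; lia.
  have [i le_ti Bi] := nzt.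
  have lt_ki : ((2 * k.+1).+1 <= i)%N by lia.
  have [_ /= Bk1] := in_E_zero BE (ltn0Sn _) Bk lt_ki Bi.
  have k_bd : (0 < k.+1 <= t)%N by lia.
  rewrite (IHk k_bd) (tail_rec (2 * k.+1).-1 BE) [E (2 * k.+1)]cvge_rec.
  rewrite prednK ?muln_gt0 // Bk1 (tail_rec (2 * k.+1) BE) Bk /=; ring.
have XtE : tail B 0 = E (2 * t) - (dig B (2 * t))%:Z * E (2 * t).+1 + tail B (2 * t).
  rewrite (Xinv t) ?t_gt0 ?leqnn // (tail_rec (2 * t).-1 BE).
  by rewrite prednK ?muln_gt0 ?t_gt0 //; ring.
(* A zero here would need a full digit at 2t-1, which is zero when [t > 1]; for [t = 1] it would
   give [tail B 0 >= m]. *)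
have Bt_gt0 : (0 < dig B (2 * t))%N.
  rewrite lt0n; apply/eqP => Bt; have [i le_ti Bi] := nzt.
  have [t1|t_neq1] := eqVneq t 1%N.
    by move: lt_Xm; rewrite XtE Bt t1 muln1 cvge2; move: tl_ge0; rewrite t1 muln1; lia.
  have t2_gt0 : (0 < 2 * t)%N by rewrite muln_gt0.
  have [_] := in_E_zero BE t2_gt0 Bt le_ti Bi.
  have -> : (2 * t).-1 = (2 * t.-1).+1 by lia.
  rewrite Bmid; last by lia.
  have := in_E_size BE Bi => i_bd.
  have A_gt0 : (0 < A (2 * t.-1).+1)%N by apply: pquot_gt0; lia.
  by move=> A0; rewrite -A0 in A_gt0.
have /andP[_ le_tr] := in_E_size BE Bt_gt0.
split=> //; first by rewrite Bt_gt0 dig_le.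
have := tail_bounds BE le_tr; rewrite XtE; lia.
Qed.


(** * Values of the intermediate convergents and the truncated chain *)

Variables (a b tau : nat).
Hypotheses (a_gt0 : (0 < a)%N) (b_gt0 : (0 < b)%N).
Hypotheses (co_ab : coprime a b) (co_ad : coprime a d).
Hypothesis tauE : (tau * d = a * m + b)%N.

Local Notation S := (sgquot (gen2 a b) d).
Local Notation height := (height d m).
Local Notation value := (value a tau).

Definition mu (i : nat) : int := (tau * cf_q c i)%:Z - (a * cf_p c i)%:Z.
Definition elt (k j : nat) : int :=
  mu (2 * k - 2)%N + j%:Z * mu (2 * k - 1)%N.

Lemma value_hpt k j : (0 < k)%N -> value (hpt k j) = elt k j.
Proof.
move=> k_gt0.
have muE i : mu i = tau%:Z * (Q i.+2)%:Z - a%:Z * (P i.+2)%:Z.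
  by rewrite /mu !PoszM.
have e0 : ((2 * k - 2).+2 = 2 * k)%N by lia.
have e1 : ((2 * k - 1).+2 = (2 * k).+1)%N by lia.
rewrite /elt !muE e0 e1 /value /hpt /= !PoszD !PoszM; ring.
Qed.

Lemma value_block k n : (0 < k)%N ->
  [seq value h | h <- block k n] = [seq elt k j | j <- index_iota 1 n.+1].
Proof.
by move=> k_gt0; rewrite -map_comp; apply: eq_map => j /=; rewrite value_hpt.
Qed.

Lemma value_chain i K : (0 < i)%N ->
  [seq value h | h <- [seq hpt k j | k <- index_iota i K.+1,
                                     j <- index_iota 1 (A (2 * k)).+1]] =
  [seq elt k j | k <- index_iota i K.+1, j <- index_iota 1 (A (2 * k)).+1].
Proof.
move=> i_gt0; rewrite map_flatten -map_comp; congr flatten.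
apply/eq_in_map => k; rewrite mem_index_iota => /andP[le_ik _] /=.
by apply: value_block; lia.
Qed.

Lemma size_blocks i K : size [seq hpt k j | k <- index_iota i K.+1,
    j <- index_iota 1 (A (2 * k)).+1] = (\sum_(i <= k < K.+1) A (2 * k))%N.
Proof.
rewrite size_allpairs_dep sumnE big_map; apply: eq_bigr => k _.
by rewrite size_iota subn1.
Qed.

Lemma hpt_neq0 k j : (0 < k)%N -> hpt k j != 0.
Proof.
move=> k_gt0; apply/eqP => -[Q0 _].
by have := @cvgq_gt0 (2 * k); lia.
Qed.

Lemma value_g0 : value (0, -1) = a%:Z.
Proof. by rewrite /value /=; ring. Qed.

Lemma value_hpt10 : value (hpt 1 0) = tau%:Z.
Proof. by rewrite hpt10 /value /=; ring. Qed.

Definition trunc (K n : nat) := hpt 1 0 :: chain K ++ block K.+1 n.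

Lemma path_trunc K n : (2 * K < r)%N -> path (step d m) (0, -1) (trunc K n).
Proof.
move=> le_Kr; rewrite /trunc /= step_hpt10 cat_path last_chain.
by rewrite path_chain ?path_block //; lia.
Qed.

Lemma last_trunc K n : last (0, -1) (trunc K n) = hpt K.+1 n.
Proof. by rewrite /= last_cat last_chain last_block. Qed.

Lemma height_trunc K n (h : int * int) : (2 * K < r)%N -> h \in trunc K n ->
  height h <= m%:Z.
Proof.
move=> lt_Kr; have /= /andP[_ path_t] := path_trunc n lt_Kr.
have h10 : height (hpt 1 0) = m%:Z.
  by rewrite height_hpt mul0r subr0 muln1 cvge2.
rewrite inE => /orP[/eqP->|h_t]; first by rewrite h10.
have /allP/(_ _ h_t) := order_path_min (@below_trans d m) (step_below path_t).
by rewrite /below h10 => /andP[/ltW].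
Qed.

(** The bounds on [a] make [hpt K.+1 n] the last point with [v < a]; its height [x] is the integer
    form of x_0. *)
Lemma Irr_trunc K n (L : seq int) (x := E (2 * K.+1) - n%:Z * E (2 * K.+1).+1) :
  (2 * K < r)%N ->
  (Q (2 * K.+1) + n * Q (2 * K.+1).+1 < a)%N ->
  (a <= Q (2 * K.+1) + n.+1 * Q (2 * K.+1).+1)%N ->
  0 < x ->
  perm_eq L [seq value h | h <- (0, -1) :: trunc K n & height h < x + b%:Z] ->
  [/\ uniq L, Posz @` Irr S = [set` L] & embdim S = size L].
Proof.
move=> lt_Kr lt_a ge_a x_gt0 permL.
have xE : height (last (0, -1) (trunc K n)) = x by rewrite last_trunc height_hpt.
apply: (Irr_chain a_gt0 b_gt0 d_gt0 co_ab co_ad tauE (path_trunc n lt_Kr)).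
- by rewrite last_trunc /= ltz_nat.
- by rewrite xE ltW.
- move=> g g_bd; rewrite last_trunc => u_bd.
  (* The next point supplies the empty box; [step_hpt] holds for every [j], so [n.+1] may pass the
     end of the block. *)
  have stp : step d m (hpt K.+1 n) (hpt K.+1 n.+1) by apply: step_hpt; lia.
  apply: (step_box _ _ stp) u_bd => //; first by rewrite height_hpt.
  by move: g_bd => /=; lia.
by rewrite xE.
Qed.

(** The chain is extended to [(d, m)], that is (u, v) = (0, d), of value [b]. Its height 0 makes the
    required box trivial, and all heights are at most [d < b], so every point gives a generator. *)
Lemma Irr_full : (d < a)%N -> (a < b)%N ->
  let L : seq int := [:: a%:Z; b%:Z; tau%:Z] ++
    [seq elt k j | k <- index_iota 1 (r %/ 2).+1,
                   j <- index_iota 1 (A (2 * k)).+1] in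
  [/\ uniq L, Posz @` Irr S = [set` L]
    & embdim S = (3 + \sum_(1 <= k < (r %/ 2).+1) A (2 * k))%N].
Proof.
move=> lt_da lt_ab L; set K := (r %/ 2)%N.
have [e1 e2] := cvge_last.
have r_gt0 : (0 < r)%N.
  by rewrite lt0n; apply/eqP => r0; move: e1; rewrite r0 cvge1; lia.
have KE : (2 * K.+1 = r.+2 \/ 2 * K.+1 = r.+1)%N by rewrite /K; lia.
have eK : E (2 * K.+1) = 1 by case: KE => ->.
have QdE : (Q r.+2 + Q r.+1 = d)%N.
  by have := cvge_cvgq r.+1; rewrite e1 e2; lia.
have Q1 : (0 < Q r.+1)%N by apply: cvgq_gt0; lia.
have Q2 : (0 < Q r.+2)%N by apply: cvgq_gt0; lia.
have QK : (Q (2 * K.+1) < d)%N by case: KE => ->; lia.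
pose s := hpt 1 0 :: rcons (chain K) (d%:Z, m%:Z).
have hK : height (hpt K.+1 0) = 1 by rewrite height_hpt eK mul0r subr0.
have h_end : height (d%:Z, m%:Z) = 0 by rewrite /height /=; ring.
have path_s : path (step d m) (0, -1) s.
  rewrite /s /= step_hpt10 rcons_path last_chain path_chain; last by lia.
  rewrite !andTb; apply/and3P; split; first by rewrite hK h_end.
    by rewrite /= mul0n addn0 ltz_nat.
  (* The determinant of this last step is the height of [hpt K.+1 0]. *)
  by apply/eqP; rewrite -hK /height /=; ring.
have last_s : last (0, -1) s = (d%:Z, m%:Z) by rewrite /s /= last_rcons.
suff permL : perm_eq L [seq value h | h <- (0, -1) :: s
    & height h < height (last (0, -1) s) + b%:Z].
  have [||x _|uL IE ->] :=
    Irr_chain a_gt0 b_gt0 d_gt0 co_ab co_ad tauE path_s _ _ _ permL.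
  - by rewrite last_s ltz_nat.
  - by rewrite last_s h_end.
  - by rewrite last_s h_end; lia.
  by split; rewrite // /L size_cat -value_chain // size_map size_blocks.
have small (h : int * int) : h \in (0, -1) :: s -> height h < b%:Z.
  move=> h_s; apply: (@le_lt_trans _ _ d%:Z); last by rewrite ltz_nat; lia.
  have h0 : height (0, -1) = d%:Z by rewrite /height /=; ring.
  move: h_s; rewrite inE => /orP[/eqP->|h_s]; first by rewrite h0.
  have /allP/(_ _ h_s) := order_path_min (@below_trans d m) (step_below path_s).
  by rewrite /below h0 => /andP[/ltW].
rewrite last_s h_end add0r (all_filterP _); last exact/allP.
rewrite /s /= value_g0 perm_cons value_hpt10 map_rcons -rcons_cons.
rewrite perm_sym perm_rcons -value_chain //.
by have -> : value (d%:Z, m%:Z) = b%:Z by rewrite /value /=; lia.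
Qed.

(* If [b <= n E], then (a, tau) is the lattice point following [hpt K n], so
   that [hpt K n] has value 1 and [d] belongs to [gen2 a b]. *)
Lemma block_lt_b K n : ~ gen2 a b d -> (0 < K)%N -> (0 < n)%N ->
  ((2 * K).+1 <= r.+2)%N ->
  (Q (2 * K) + n * Q (2 * K).+1 < a <= Q (2 * K) + n.+1 * Q (2 * K).+1)%N ->
  n%:Z * E (2 * K).+1 < E (2 * K) -> n%:Z * E (2 * K).+1 < b%:Z.
Proof.
move=> notS K_gt0 n_gt0 le_Kr a_bd nE; rewrite ltNge; apply/negP => b_le.
have E1_gt0 : 0 < E (2 * K).+1 by apply: cvge_gt0; lia.
have Q0_gt0 : (0 < Q (2 * K))%N by apply: cvgq_gt0; lia.
have Q1_gt0 : (0 < Q (2 * K).+1)%N by apply: cvgq_gt0; lia.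
have det : (Q (2 * K))%:Z * (P (2 * K).+1)%:Z - (Q (2 * K).+1)%:Z * (P (2 * K))%:Z = 1.
  by rewrite cvg_det exprM sqrrN !expr1n.
have E0E : E (2 * K) = (Q (2 * K))%:Z * m%:Z - (P (2 * K))%:Z * d%:Z.
  by rewrite /E exprM sqrrN !expr1n mul1r.
have E1E : E (2 * K).+1 = - ((Q (2 * K).+1)%:Z * m%:Z - (P (2 * K).+1)%:Z * d%:Z).
  by rewrite /E exprS exprM sqrrN !expr1n mulr1 mulN1r.
have tauEz : tau%:Z * d%:Z = a%:Z * m%:Z + b%:Z by lia.
(* [x] and [y] are the coordinates of [(a, tau)] in the basis formed by the convergents of indices
   2K-2 and 2K-1. *)
pose x := a%:Z * (P (2 * K).+1)%:Z - tau%:Z * (Q (2 * K).+1)%:Z.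
pose y := tau%:Z * (Q (2 * K))%:Z - a%:Z * (P (2 * K))%:Z.
have aE : a%:Z = x * (Q (2 * K))%:Z + y * (Q (2 * K).+1)%:Z.
  rewrite -[LHS]mulr1 -det /x /y; ring.
have bE : b%:Z = y * E (2 * K).+1 - x * E (2 * K).
  have -> : b%:Z = tau%:Z * d%:Z - a%:Z * m%:Z by rewrite tauEz; ring.
  rewrite -[LHS]mulr1 -det E0E E1E /x /y; ring.
have vE : value (hpt K n) = y - n%:Z * x.
  by rewrite /value /hpt /= !PoszD !PoszM /x /y; ring.
have q_ge0 : 0 <= (hpt K n).1 by [].
have u_ge0 : 0 <= height (hpt K n) by rewrite height_hpt subr_ge0 ltW.
have [v [Sv _ vE']] := value_mem a_gt0 b_gt0 d_gt0 co_ab co_ad tauE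
  q_ge0 u_ge0 (hpt_neq0 n K_gt0).
suff xy : x = 1 /\ y = n%:Z + 1.
  apply: notS; have v1 : v = 1%N by move: vE'; rewrite vE; lia.
  by move: Sv; rewrite v1 /sgquot /= muln1.
move: x y aE bE {vE vE' Sv q_ge0 u_ge0 det E0E E1E} => x y aE bE.
move: (E (2 * K)) (E (2 * K).+1) (Q (2 * K)) (Q (2 * K).+1) nE b_le E1_gt0
  Q0_gt0 Q1_gt0 a_bd aE bE => e0 e1 q0 q1 nE b_le e1_gt0 q0_gt0 q1_gt0 a_bd aE bE.
(* For [x <= 0] the bound on [b] gives [y <= n], which makes [a] too small. For [x > 0], positivity
   of [b] gives [y > x n], and the upper bound on [a] leaves only [x = 1] and [y = n + 1]. *)
have [x_le0|x_gt0] := lerP x 0.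
  exfalso; have le_yn : y <= n%:Z.
    rewrite leNgt; apply/negP => lt_ny.
    have : 0 <= - x * e0 by apply: mulr_ge0; lia.
    have : 0 <= (y - n%:Z - 1) * e1 by apply: mulr_ge0; lia.
    by lia.
  have : 0 <= - x * q0%:Z by apply: mulr_ge0; lia.
  have : 0 <= (n%:Z - y) * q1%:Z by apply: mulr_ge0; lia.
  by lia.
have lt_y : x * n%:Z < y.
  rewrite ltNge; apply/negP => le_y.
  have : 0 <= (x * n%:Z - y) * e1 by apply: mulr_ge0; lia.
  have : 0 <= x * (e0 - n%:Z * e1) by apply: mulr_ge0; lia.
  by lia.
have x1 : x = 1.
  have [//|x_neq1] := eqVneq x 1; exfalso.
  have : 0 <= (y - x * n%:Z - 1) * q1%:Z by apply: mulr_ge0; lia.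
  have : 0 <= (x - 2) * (q0%:Z + n%:Z * q1%:Z) by apply: mulr_ge0; lia.
  have : 0 <= n%:Z * q1%:Z by [].
  by lia.
split=> //; rewrite x1 mul1r in lt_y aE.
have [//|y_neq] := eqVneq y (n%:Z + 1); exfalso.
have : 0 <= (y - n%:Z - 2) * q1%:Z by apply: mulr_ge0; lia.
by lia.
Qed.

(** * The cases with [a < d] *)

Lemma index_iota_cat i j k : (i <= j <= k)%N ->
  index_iota i k = index_iota i j ++ index_iota j k.
Proof.
move=> /andP[le_ij le_jk]; rewrite /index_iota.
by rewrite -[in X in _ ++ iota X _](subnKC le_ij) -iotaD; congr iota; lia.
Qed.

(** Heights decrease along the chain, and the bounds on [X], shaped as in [numeration_rat_bounds],
    put the cut-off just before [hpt t bt]. With [X = x0 + b - 1] the filter is the one of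
    [Irr_trunc]. *)
Lemma filter_trunc K n t bt (X : int) :
  (2 * K < r)%N -> (0 < t <= K)%N -> (0 < bt <= A (2 * t))%N ->
  E (2 * t) - bt%:Z * E (2 * t).+1 <= X ->
  X < E (2 * t) - (bt%:Z - 1) * E (2 * t).+1 ->
  [seq h <- (0, -1) :: trunc K n | height h < X + 1] =
  [seq hpt t j | j <- index_iota bt (A (2 * t)).+1] ++
  [seq hpt k j | k <- index_iota t.+1 K.+1, j <- index_iota 1 (A (2 * k)).+1] ++
  block K.+1 n.
Proof.
move=> lt_Kr /andP[t_gt0 le_tK] /andP[bt_gt0 le_bt] leX ltX.
have Et_gt0 : 0 < E (2 * t).+1 by apply: cvge_gt0; lia.
have splitK : chain K = chain t.-1 ++ [seq hpt t j | j <- index_iota 1 bt] ++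
    [seq hpt t j | j <- index_iota bt (A (2 * t)).+1] ++
    [seq hpt k j | k <- index_iota t.+1 K.+1, j <- index_iota 1 (A (2 * k)).+1].
  rewrite /chain prednK // (@index_iota_cat 1 t) ?map_cat ?flatten_cat; last by lia.
  congr (_ ++ _); have -> : index_iota t K.+1 = t :: index_iota t.+1 K.+1.
    by rewrite /index_iota subSS subSn.
  by rewrite /= (@index_iota_cat 1 bt) ?map_cat ?catA //; lia.
have EtX : X < E (2 * t).
  have : 0 <= (bt%:Z - 1) * E (2 * t).+1 by apply: mulr_ge0; lia.
  by lia.
have Etm : E (2 * t) <= m%:Z.
  by rewrite -cvge2; apply: (@cvge_even_le 1 t); lia.
have hi_k k j : (0 < k < t)%N -> (j <= A (2 * k))%N -> X < height (hpt k j).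
  move=> k_bd le_j; apply: lt_le_trans EtX _; rewrite height_hpt.
  have Ek_gt0 : 0 < E (2 * k).+1 by apply: cvge_gt0; lia.
  apply: (@le_trans _ _ (E (2 * k.+1))); first by apply: cvge_even_le; lia.
  rewrite mulnS add2n [E (2 * k)]cvge_rec.
  have : 0 <= ((A (2 * k))%:Z - j%:Z) * E (2 * k).+1 by apply: mulr_ge0; lia.
  by lia.
have hi_t j : (j < bt)%N -> X < height (hpt t j).
  move=> lt_j; rewrite height_hpt.
  have : 0 <= (bt%:Z - 1 - j%:Z) * E (2 * t).+1 by apply: mulr_ge0; lia.
  by lia.
have lo_t j : (bt <= j)%N -> height (hpt t j) <= X.
  move=> le_j; rewrite height_hpt.
  have : 0 <= (j%:Z - bt%:Z) * E (2 * t).+1 by apply: mulr_ge0; lia.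
  by lia.
have lo_k k j : (t < k <= K.+1)%N -> height (hpt k j) <= X.
  move=> k_bd; have Ek_gt0 : 0 < E (2 * k).+1 by apply: cvge_gt0; lia.
  apply: (@le_trans _ _ (E (2 * k))).
    by rewrite height_hpt lerBlDr lerDl mulr_ge0 // ltW.
  apply: (@le_trans _ _ (E (2 * t.+1))); first by apply: cvge_even_le; lia.
  have : 0 <= ((A (2 * t))%:Z - bt%:Z) * E (2 * t).+1 by apply: mulr_ge0; lia.
  by have := cvge_rec (2 * t); rewrite mulnS add2n; lia.
have h0 : height (0, -1) = d%:Z by rewrite /height /=; ring.
have h10 : height (hpt 1 0) = m%:Z.
  by rewrite height_hpt mul0r subr0 muln1 cvge2.
rewrite /trunc splitK [LHS]/= h0 h10.
have -> : (d%:Z < X + 1) = false by lia.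
have -> : (m%:Z < X + 1) = false by lia.
rewrite !filter_cat.
have -> : [seq h <- chain t.-1 | height h < X + 1] = [::].
  apply/eqP; rewrite -[_ == _]negbK -has_filter; apply/hasPn => h.
  case/allpairsPdep=> k [j []]; rewrite !mem_index_iota => k_bd j_bd ->.
  have : X < height (hpt k j) by apply: hi_k; lia.
  by lia.
have -> : [seq h <- [seq hpt t j | j <- index_iota 1 bt] | height h < X + 1] = [::].
  apply/eqP; rewrite -[_ == _]negbK -has_filter; apply/hasPn => h.
  case/mapP=> j; rewrite mem_index_iota => j_bd ->.
  have : X < height (hpt t j) by apply: hi_t; lia.
  by lia.
rewrite /= -catA; congr (_ ++ (_ ++ _)); apply/all_filterP/allP => h.
- case/mapP=> j; rewrite mem_index_iota => j_bd ->.
  by have := @lo_t j; lia.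
- case/allpairsPdep=> k [j []]; rewrite !mem_index_iota => k_bd j_bd ->.
  by have := @lo_k k j; lia.
case/mapP=> j _ ->.
by have := @lo_k K.+1 j; lia.
Qed.

Lemma delta_cvge k : d%:R * cf_delta (m%:R / d%:R) c k = (E k.+2)%:~R.
Proof.
have d_neq0 : d%:R != 0 :> rat by rewrite pnatr_eq0 -lt0n.
have sgn : (-1 : int) ^+ k.+2 = (-1) ^+ k by rewrite !exprS !mulN1r opprK.
rewrite /cf_delta /E sgn rmorphM rmorphXn rmorphN1 mulrCA; congr (_ * _).
rewrite rmorphB !rmorphM /= mulrBr -!pmulrn /cvgq /cvgp /cf_q /cf_p.
by rewrite [d%:R * (_ * _)]mulrC -mulrA mulfVK // [d%:R * _]mulrC.
Qed.

Lemma tail_numeration_rat beta B : numeration_rat (m%:R / d%:R) c beta B ->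
  (tail B 0)%:~R = d%:R * beta.
Proof.
move=> [_ ->]; rewrite big_add1 /= mulr_sumr rmorph_sum /=.
apply: eq_bigr => j _; rewrite subn0 [RHS]mulrCA delta_cvge.
by rewrite !rmorphM rmorphXn rmorphN1 /= -pmulrn.
Qed.


(** Values are injective for [0 <= v < a], and [a] is already the value of [(0, -1)]. *)
Lemma value_trunc_neq K n (h : int * int) : (2 * K < r)%N ->
  (Q (2 * K.+1) + n * Q (2 * K.+1).+1 < a)%N -> h \in trunc K n ->
  value h <> a%:Z.
Proof.
move=> lt_Kr lt_a h_t vh; have path_t := path_trunc n lt_Kr.
have h_t0 : h \in (0, -1) :: trunc K n by rewrite inE h_t orbT.
have [_ ] := chain_last path_t h_t0; rewrite last_trunc /= => h_le.
have /allP/(_ _ h_t) := order_path_min (@below_trans d m) (step_below path_t).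
move=> /andP[lt_u /= lt_q].
have h_bd : 0 <= h.1 < a%:Z by lia.
have : h = (0, -1).
  apply: (value_inj a_gt0 b_gt0 d_gt0 co_ab co_ad tauE h_bd); rewrite ?value_g0 //=.
by move=> hE; rewrite hE ltxx in lt_u.
Qed.

Arguments trunc : simpl never.

(** The cases differ by which of the first two points, of heights [d] and [m], pass the bound
    [x0 + b]: both, only the second, or neither. *)
Lemma Irr_truncated (N : seq nat) (s : nat) :
  ~ gen2 a b d -> (a < d)%N -> numeration_nat c (a - 1) N -> last_nonzero N s ->
  let alpha : rat := m%:R / d%:R in
  let delta := cf_delta alpha c in
  let Ns := dig N s in
  let x0 : rat :=
    if odd s then d%:R * delta (s - 1)%N
    else d%:R * (delta (s - 2)%N - Ns%:R * delta (s - 1)%N) in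
  let nu := if odd s then 0%N else Ns in
  let L0 : seq int := tau%:Z ::
    [seq elt k j | k <- index_iota 1 ((s - 1) %/ 2).+1,
                   j <- index_iota 1 (A (2 * k)).+1] ++
    (if odd s then [::]
     else [seq mu (s - 2)%N + j%:Z * mu (s - 1)%N
          | j <- index_iota 1 Ns.+1]) in
  [/\ (a < d < b)%N \/ (a < b < d)%N /\ d%:R < x0 + b%:R ->
        [/\ uniq (a%:Z :: L0), Posz @` Irr S = [set` a%:Z :: L0] &
            embdim S = (2 + \sum_(1 <= k < ((s - 1) %/ 2).+1) A (2 * k) + nu)%N],
      (a < b < d)%N -> m%:R < x0 + b%:R <= d%:R ->
        [/\ uniq L0, Posz @` Irr S = [set` L0], ~ Irr S a &
            embdim S = (1 + \sum_(1 <= k < ((s - 1) %/ 2).+1) A (2 * k) + nu)%N] &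
      (a < b < d)%N -> x0 + b%:R <= m%:R ->
        forall (B : seq nat) (s' t : nat),
        let beta : rat := (x0 + b%:R - 1) / d%:R in
        numeration_rat alpha c beta B -> last_nonzero B s' -> is_t B s' t ->
        let lo := fun k : nat => if k == t then dig B (2 * k) else 1%N in
        let hi := fun k : nat => if (2 * k < s)%N then A (2 * k) else Ns in
        let L : seq int :=
          [seq elt k j | k <- index_iota t (s %/ 2).+1,
                         j <- index_iota (lo k) (hi k).+1] in
        [/\ ~ Irr S a, uniq L, Posz @` Irr S = [set` L] &
            embdim S = (1 + A (2 * t) - dig B (2 * t)
              + \sum_(t + 1 <= k < ((s - 1) %/ 2).+1) A (2 * k) + nu)%N]].
Proof.
move=> notS lt_ad numN lastN alpha delta Ns x0 nu L0.
have [s_bd Ns_bd] := numeration_nat_bounds numN lastN.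
rewrite -/Ns in Ns_bd * => a_bd; set K := ((s - 1) %/ 2)%N.
(* For odd [s] the chain ends at the convergent of index s-1, with nothing from block [K.+1]; for
   even [s] it ends inside block s/2 at [j = N_s]. *)
have nuP : (nu = 0 /\ 2 * K.+1 = s.+1 \/ [/\ nu = Ns, 2 * K.+1 = s & ~~ odd s])%N.
  by rewrite /nu /K; case: ifP => odd_s; [left | right]; split=> //; lia.
pose x := E (2 * K.+1) - nu%:Z * E (2 * K.+1).+1.
have lt_Kr : (2 * K < r)%N by case: nuP => -[]; lia.
have EK_gt0 : 0 < E (2 * K.+1).+1 by apply: cvge_gt0; lia.
have qK : (Q (2 * K.+1) + nu * Q (2 * K.+1).+1 < a <=
           Q (2 * K.+1) + nu.+1 * Q (2 * K.+1).+1)%N.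
  case: nuP => [[-> ->]|[-> -> _]]; last by lia.
  have /andP[Ns_gt0 Ns_le] := Ns_bd.
  have : (Ns * Q s.+1 <= A s * Q s.+1)%N by rewrite leq_mul2r Ns_le orbT.
  have : (1 * Q s.+1 <= Ns * Q s.+1)%N by rewrite leq_mul2r Ns_gt0 orbT.
  by have := cvgq_rec s; lia.
have nuE : nu%:Z * E (2 * K.+1).+1 <= E (2 * K.+1) - E (2 * K.+1).+2 \/ nu = 0%N.
  case: nuP => [[-> _]|[-> -> _]]; [by right | left].
  have Es_gt0 : 0 < E s.+1 by apply: cvge_gt0; lia.
  have : 0 <= ((A s)%:Z - Ns%:Z) * E s.+1 by apply: mulr_ge0; lia.
  by have := cvge_rec s; lia.
have x_gt0 : 0 < x.
  rewrite /x; case: nuP => [[-> _]|[nuNs sE _]].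
    by rewrite mul0r subr0 cvge_gt0 //; lia.
  have Es_gt0 : 0 < E (2 * K.+1).+2 by apply: cvge_gt0; lia.
  by case: nuE; lia.
have x0E : x0 = x%:~R.
  rewrite /x0 /x; case: nuP => [[nu0 sE]|[nuNs sE nodd]].
    have odd_s : odd s by lia.
    rewrite odd_s delta_cvge nu0 mul0r subr0 sE.
    by congr (E _)%:~R; lia.
  rewrite (negbTE nodd) mulrBr [d%:R * (Ns%:R * _)]mulrCA !delta_cvge.
  rewrite sE nuNs.
  have -> : ((s - 2).+2 = s)%N by lia.
  have -> : ((s - 1).+2 = s.+1)%N by lia.
  by rewrite [RHS]intrB [(Ns%:Z * _)%:~R]intrM.
have L0E : L0 = [seq value h | h <- trunc K nu].
  rewrite /L0 /trunc /= value_hpt10 map_cat value_chain // value_block //; congr (_ :: _ ++ _).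
  case: nuP => [[nu0 sE]|[nuNs sE nodd]]; first by rewrite nu0 ifT //; lia.
  by rewrite (negbTE nodd) nuNs /elt sE.
have sizeL0 : size L0 = (1 + \sum_(1 <= k < K.+1) A (2 * k) + nu)%N.
  by rewrite L0E size_map /trunc /= size_cat size_blocks size_map size_iota subn1.
have /andP[qK1 qK2] := qK.
pose G := [seq h <- trunc K nu | height h < x + b%:Z].
have h0 : height (0, -1) = d%:Z by rewrite /height /=; ring.
have IrrP L :
    perm_eq L (if d%:Z < x + b%:Z then a%:Z :: [seq value h | h <- G]
               else [seq value h | h <- G]) ->
    [/\ uniq L, Posz @` Irr S = [set` L] & embdim S = size L].
  move=> permL; apply: (Irr_trunc lt_Kr qK1 qK2 x_gt0).
  by rewrite /= h0; move: permL; case: ifP => //=; rewrite value_g0.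
have castE (n : nat) : n%:R = (n%:Z)%:~R :> rat by rewrite -pmulrn.
have trunc_small : m%:Z < x + b%:Z -> G = trunc K nu.
  move=> lt_m; apply/all_filterP/allP => h /(height_trunc lt_Kr) h_le.
  exact: le_lt_trans h_le lt_m.
have IrrNa (L : seq int) : Posz @` Irr S = [set` L] -> a%:Z \notin L -> ~ Irr S a.
  move=> IE aL Ia; case/negP: aL.
  by have : (Posz @` Irr S) a%:Z by [exists a]; rewrite IE.
have a_notin (F : pred (int * int)) :
    a%:Z \notin [seq value h | h <- trunc K nu & F h].
  apply/mapP => -[h]; rewrite mem_filter => /andP[_ h_t] vh.
  exact: (value_trunc_neq lt_Kr qK1 h_t).
rewrite x0E; split.
- move=> cond; have lt_d : d%:Z < x + b%:Z.
    case: cond => [b_bd|[_]]; first by lia.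
    by rewrite !castE -rmorphD ltr_int.
  have [|uL IE ->] := IrrP (a%:Z :: L0).
    by rewrite lt_d trunc_small ?L0E //; lia.
  by split; rewrite // -[size _]/(size L0).+1 sizeL0.
- move=> b_bd; rewrite !castE -!rmorphD ltr_int ler_int => /andP[lt_m le_d].
  have [|uL IE ->] := IrrP L0.
    by rewrite ltNge le_d trunc_small ?L0E.
  split=> //.
  apply: IrrNa IE _; rewrite L0E -[X in map _ X]filter_predT; exact: a_notin.
move=> b_bd; rewrite !castE -!rmorphD ler_int => le_m B s' t beta.
move=> numB lastB t_def lo hi L.
have XE : tail B 0 = x + b%:Z - 1.
  apply: (@intr_inj rat); rewrite (tail_numeration_rat numB) /beta mulrC divfK.
    by rewrite [RHS]intrB.

  by rewrite pnatr_eq0 -lt0n.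
have lt_Xm : tail B 0 < m%:Z by rewrite XE; lia.
have [t_gt0 le_tr Bt_bd] := numeration_rat_bounds (proj1 numB) lastB t_def lt_Xm.
rewrite XE => /andP[leX ltX].
have Et_gt0 : 0 < E (2 * t).+1 by apply: cvge_gt0; lia.
have lt_xEt : x + b%:Z - 1 < E (2 * t).
  have : 0 <= ((dig B (2 * t))%:Z - 1) * E (2 * t).+1 by apply: mulr_ge0; lia.
  by lia.
(* The cut-off cannot fall in the final partial block: since [d] is not in [gen2 a b], [block_lt_b]
   gives [x + b - 1 >= E (2 * K.+1)] there. Larger [t] would give [E (2 * t) <= x]. *)
have le_tK : (t <= K)%N.
  rewrite leqNgt; apply/negP => lt_Kt.
  have le_Et : E (2 * t) <= E (2 * K.+1) by apply: cvge_even_le; lia.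
  have [nu0|nu_gt0] := posnP nu.
    by move: lt_xEt; rewrite /x nu0; lia.
  case: nuE => nuE; last by lia.
  have [tK|t_neq] := eqVneq t K.+1.
    have EK2_gt0 : 0 < E (2 * K.+1).+2.
      by case: nuP => -[]; [lia | move=> _ sE _; apply: cvge_gt0; lia].
    have : nu%:Z * E (2 * K.+1).+1 < b%:Z.
      by apply: (block_lt_b notS) => //; lia.
    by move: lt_xEt; rewrite tK /x; lia.
  have : E (2 * t) <= E (2 * K.+2) by apply: cvge_even_le; lia.
  by rewrite [(2 * K.+2)%N]mulnS add2n; move: lt_xEt; rewrite /x; lia.
have lt_d : (d%:Z < x + b%:Z) = false by lia.
have GE : G = [seq h <- (0, -1) :: trunc K nu | height h < x + b%:Z].
  by rewrite /= h0 lt_d.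
have LE : L = [seq value h | h <- G].
  have xbE : x + b%:Z = x + b%:Z - 1 + 1 by rewrite subrK.
  rewrite GE xbE.
  rewrite (filter_trunc nu lt_Kr (_ : (0 < t <= K)%N) Bt_bd leX ltX); last by lia.
  rewrite !map_cat value_chain // value_block //.
  have -> : [seq value h | h <- [seq hpt t j
                 | j <- index_iota (dig B (2 * t)) (A (2 * t)).+1]] =
      [seq elt t j | j <- index_iota (lo t) (hi t).+1].
    rewrite -map_comp /lo /hi eqxx ifT; last by case: nuP => -[]; lia.
    by apply: eq_map => j /=; rewrite value_hpt.
  have -> : [seq elt k j | k <- index_iota t.+1 K.+1, j <- index_iota 1 (A (2 * k)).+1] =
      [seq elt k j | k <- index_iota t.+1 K.+1, j <- index_iota (lo k) (hi k).+1].
    congr flatten; apply/eq_in_map => k; rewrite mem_index_iota => k_bd.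
    rewrite /lo /hi ifF; last by lia.
    by rewrite ifT //; case: nuP => -[]; lia.
  have tK : index_iota t K.+1 = t :: index_iota t.+1 K.+1.
    by rewrite /index_iota subSS subSn.
  (* The range ends at [s %/ 2], which is [K] for odd [s]; for even [s] it is [K.+1], whose term is
     the partial block. *)
  case: nuP => [[nu0 sE]|[nuNs sE nodd]].
    have sK : (s %/ 2 = K)%N by lia.
    by rewrite /L sK tK nu0 /= cats0.
  have sK : (s %/ 2 = K.+1)%N by lia.
  have KK : index_iota K.+1 K.+2 = [:: K.+1] by rewrite /index_iota subSn // subnn.
  rewrite /L sK (@index_iota_cat t K.+1) ?tK ?KK; last by lia.
  rewrite map_cat flatten_cat /= cats0.
  have loK : lo K.+1 = 1%N by rewrite /lo ifF //; lia.
  have hiK : hi K.+1 = Ns by rewrite /hi sE ltnn.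
  by rewrite loK hiK nuNs catA.
have [|uL IE ->] := IrrP L; first by rewrite lt_d LE.
split=> //.
  apply: IrrNa IE _; rewrite LE; exact: a_notin.
have -> : size L = size [seq h <- (0, -1) :: trunc K nu | height h < x + b%:Z - 1 + 1].
  by rewrite LE size_map GE subrK.
rewrite (filter_trunc nu lt_Kr (_ : (0 < t <= K)%N) Bt_bd leX ltX); last by lia.
rewrite !size_cat !size_map size_blocks !size_iota subn1 addn1 addnA.
by congr (_ + _ + _)%N; lia.
Qed.

End Convergents.

Theorem theorem5 (a b d m : nat) (c : seq nat) :
  (0 < a)%N -> (0 < b)%N -> (0 < d)%N ->
  coprime a b -> coprime a d -> coprime b d ->
  ~ gen2 a b d ->
  (1 <= m <= d - 1)%N -> a * m + b = 0 %[mod d] ->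
  let alpha : rat := m%:R / d%:R in
  is_cf alpha c ->
  let Sd := sgquot (gen2 a b) d in
  let r := size c in
  let delta := cf_delta alpha c in
  let tau := ((a * m + b) %/ d)%N in
  let mu := fun i : nat => (tau * cf_q c i)%:Z - (a * cf_p c i)%:Z in
  let elt := fun k j : nat => mu (2 * k - 2)%N + j%:Z * mu (2 * k - 1)%N in
  (* Case 1 *)
  ((d < a)%N -> (a < b)%N ->
     let L : seq int := [:: a%:Z; b%:Z; tau%:Z] ++
       [seq elt k j | k <- index_iota 1 (r %/ 2).+1,
                      j <- index_iota 1 (pquot c (2 * k)).+1] in
     [/\ uniq L,
         Posz @` Irr Sd = [set` L] &
         embdim Sd =
           (3 + \sum_(1 <= k < (r %/ 2).+1) pquot c (2 * k))%N]) /\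
  (forall (N : seq nat) (s : nat),
     (a < d)%N -> numeration_nat c (a - 1) N -> last_nonzero N s ->
     let Ns := dig N s in
     let x0 : rat :=
       if odd s then d%:R * delta (s - 1)%N
       else d%:R * (delta (s - 2)%N - Ns%:R * delta (s - 1)%N) in
     let nu := if odd s then 0%N else Ns in
     let L0 : seq int := tau%:Z ::
       [seq elt k j | k <- index_iota 1 ((s - 1) %/ 2).+1,
                      j <- index_iota 1 (pquot c (2 * k)).+1] ++
       (if odd s then [::]
        else [seq mu (s - 2)%N + j%:Z * mu (s - 1)%N
             | j <- index_iota 1 Ns.+1]) in
     [/\ (* Case 2 *)
         ((a < d < b)%N \/ (a < b < d)%N /\ d%:R < x0 + b%:R ->
            [/\ uniq (a%:Z :: L0),
                Posz @` Irr Sd = [set` a%:Z :: L0] &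
                embdim Sd =
                  (2 + \sum_(1 <= k < ((s - 1) %/ 2).+1) pquot c (2 * k)
                     + nu)%N]),
         (* Case 3 *)
         ((a < b < d)%N -> m%:R < x0 + b%:R <= d%:R ->
            [/\ uniq L0,
                Posz @` Irr Sd = [set` L0],
                ~ Irr Sd a &
                embdim Sd =
                  (1 + \sum_(1 <= k < ((s - 1) %/ 2).+1) pquot c (2 * k)
                     + nu)%N]) &
         (* Case 4 *)
         ((a < b < d)%N -> x0 + b%:R <= m%:R ->
            forall (B : seq nat) (s' t : nat),
            let beta : rat := (x0 + b%:R - 1) / d%:R in
            numeration_rat alpha c beta B -> last_nonzero B s' -> is_t B s' t ->
            let lo := fun k : nat => if k == t then dig B (2 * k) else 1%N in
            let hi := fun k : nat =>
              if (2 * k < s)%N then pquot c (2 * k) else Ns in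
            let L : seq int :=
              [seq elt k j | k <- index_iota t (s %/ 2).+1,
                             j <- index_iota (lo k) (hi k).+1] in
            [/\ ~ Irr Sd a,
                uniq L,
                Posz @` Irr Sd = [set` L] &
                embdim Sd =
                  (1 + pquot c (2 * t) - dig B (2 * t)
                     + \sum_(t + 1 <= k < ((s - 1) %/ 2).+1) pquot c (2 * k)
                     + nu)%N])]).
Proof.
move=> a_gt0 b_gt0 d_gt0 co_ab co_ad co_bd notS m_bd am0 alpha cf_c.
move=> Sd r delta tau mu elt.
have m_gt0 : (0 < m)%N by lia.
have lt_md : (m < d)%N by lia.
have d_dvd : (d %| a * m + b)%N by rewrite /dvdn am0 mod0n.
have tauE : (tau * d = a * m + b)%N by rewrite divnK.
(* A common divisor of [m] and [d] divides [b], because [d] divides [a m + b]. *)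
have co_md : coprime m d.
  rewrite /coprime -dvdn1 -(eqP co_bd) dvdn_gcd dvdn_gcdr andbT.
  rewrite -(@dvdn_addr (a * m)) ?dvdn_mull ?dvdn_gcdl //.
  by rewrite (dvdn_trans _ d_dvd) ?dvdn_gcdr.
split; first exact: (Irr_full d_gt0 m_gt0 lt_md co_md cf_c).
by move=> N s lt_ad numN lastN; apply: (Irr_truncated d_gt0 m_gt0 lt_md co_md cf_c).
Qed.
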